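(* Let $n>k\ge2$ and $V=\mathbb{C}^k$. The space $\mathrm{Conf}_n\mathbb{P}^{k-1}$ has the structure of a cluster $\mathcal{X}$-variety. This $\mathcal{X}$-variety, together with the $\mathcal{A}$-variety $\mathrm{Conf}_nV$, forms a cluster ensemble; that is, for every seed $\Sigma$ of the cluster structure on $\mathrm{Conf}_nV$, with cluster variables $A_j$ ($j\in I$) and exchange matrix $B=(B_{ij})$, the $\mathcal{X}$-coordinates $X_i$ ($i$ non-frozen) give a birational coordinate system on $\mathrm{Conf}_n\mathbb{P}^{k-1}$, coordinate systems of mutation-equivalent seeds being related by $\mathcal{X}$-mutations, and the canonical map $p:\mathrm{Conf}_nV\to\mathrm{Conf}_n\mathbb{P}^{k-1}$ is given by $p^*(X_i)=\prod_{j\in I}A_j^{B_{ij}}$.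
   Context: $\mathrm{Conf}_nV=SL_k\backslash V^n$ is identified with the affine cone over $\mathrm{Gr}(k,n)$; $\mathrm{Conf}_n\mathbb{P}^{k-1}=\mathrm{Conf}_nV/T^n$ is the space of configurations of $n$ points in $\mathbb{P}(V)$, where $T^n=(\mathbb{C}^* )^n$ rescales the $n$ vectors; $p$ is the quotient map. **Seeds.** A (skew-symmetric) seed $\Sigma$ is an index set $I$ with a subset $I_0$ of frozen indices and an integer skew-symmetric matrix $B=(b_{ij})$ (entries between frozen indices are irrelevant), encoded by a quiver with $b_{ij}$ arrows from $j$ to $i$ when $b_{ij}>0$. Mutation at non-frozen $m$: $b'_{ij}=-b_{ij}$ if $i=m$ or $j=m$; $b'_{ij}=b_{ij}$ if $b_{im}b_{mj}\le0$; $b'_{ij}=b_{ij}+|b_{im}|b_{mj}$ if $b_{im}b_{mj}>0$. Cluster variables mutate by $A'_i=A_i$ ($i\ne m$), $A'_m=A_m^{-1}\bigl(\prod_{b_{mj}>0}A_j^{b_{mj}}+\prod_{b_{mj}<0}A_j^{-b_{mj}}\bigr)$. $\mathcal{X}$-coordinates mutate by $X'_m=X_m^{-1}$ and $X'_i=X_iX_m^{[b_{im}]_+}(1+X_m)^{-b_{im}}$ ($i\neq m$), with $[b]_+=\max(0,b)$; here $\mathcal{X}$-coordinates are attached only to the non-frozen indices. A cluster ensemble consists of an $\mathcal{A}$-space and an $\mathcal{X}$-space built from the same seeds, with the map $p^*(X_i)=\prod_{j}A_j^{B_{ij}}$. **Cluster structure on $\mathrm{Conf}_nV$ (Scott).**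 $P_J=\det(v_{j_1},\dots,v_{j_k})$ for $J=\{j_1<\dots<j_k\}$. The initial cluster consists of $P_*=P_{\{1,\dots,k\}}$ and $P_{b,e}=P_{\{1,\dots,k-b\}\cup\{e-b+1,\dots,e\}}$ for $1\le b\le k$, $k+1\le e\le n$. Arrows: $(b,e)\to(b,e+1)$ for $b<k$; $(b,e)\to(b+1,e)$; $(b,e)\to(b-1,e-1)$; $*\to(1,k+1)$ (whenever both ends exist). The frozen vertices are $*$, all $(k,e)$ and all $(b,n)$. *)

(* Defs.v *)
From HB Require Import structures.
From mathcomp Require Import all_boot all_order all_algebra.
From mathcomp Require Import boolp reals complex mpoly.

Set Implicit Arguments.
Unset Strict Implicit.
Unset Printing Implicit Defensive.

Import Order.TTheory GRing.Theory Num.Theory.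
Local Open Scope ring_scope.

(* A seed with index set [I]; the frozen subset is never changed by a mutation,
   so it is a parameter of the notions below rather than a field. *)
Record seed (I : finType) (F : fieldType) := Seed {
  exch : I -> I -> int;
  exch_skew : forall i j, exch i j = - exch j i;
  clvar : I -> F }.

Section Mutation.
Variables (I : finType) (F : fieldType).

Definition mutB (b : I -> I -> int) (m i j : I) : int :=
  if (i == m) || (j == m) then - b i j
  else if b i m * b m j <= 0 then b i j
  else b i j + `|b i m| * b m j.

Definition mutA (b : I -> I -> int) (A : I -> F) (m i : I) : F :=
  if i == m then
    (A m)^-1 * (\prod_(j | 0 < b m j) A j ^ b m j
                + \prod_(j | b m j < 0) A j ^ (- b m j))
  else A i.

Lemma mutB_skew (b : I -> I -> int) m : (forall i j, b i j = - b j i) ->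
  forall i j, mutB b m i j = - mutB b m j i.
Proof.
move=> sk i j; rewrite /mutB [(j == m) || _]orbC.
case: ifP => _; first by rewrite (sk i j).
rewrite (sk j m) (sk m i) mulrNN [b m j * _]mulrC.
case: (lerP (b i m * b m j) 0) => [_ | h]; first exact: sk.
rewrite (sk i j) normrN mulrN opprD opprK; congr (_ + _).
case: (ltrgt0P (b i m)) h => [p|p|->]; last by rewrite mul0r ltxx.
  by rewrite pmulr_rgt0 // => q; rewrite !gtr0_norm // mulrC.
by rewrite nmulr_rgt0 // => q; rewrite !ltr0_norm // !mulNr mulrC.
Qed.

Definition mutate (m : I) (S : seed I F) : seed I F :=
  Seed (mutB_skew m (exch_skew S)) (mutA (exch S) (clvar S) m).

Inductive mutation_equivalent (frozen : {set I}) (S0 : seed I F) :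
    seed I F -> Prop :=
| ME_refl : mutation_equivalent frozen S0 S0
| ME_step S m : m \notin frozen -> mutation_equivalent frozen S0 S ->
    mutation_equivalent frozen S0 (mutate m S).

End Mutation.

Definition unfrozen (I : finType) (frozen : {set I}) := {i : I | i \notin frozen}.

Definition mutX (I : finType) (F : fieldType) (frozen : {set I})
    (b : I -> I -> int) (x : unfrozen frozen -> F) (m i : unfrozen frozen) : F :=
  if i == m then (x m)^-1
  else x i * x m ^ Num.max 0 (b (val i) (val m))
       * (1 + x m) ^ (- b (val i) (val m)).

(* For a variety with function field [L] over [C], a finite family of rational
   functions is a birational coordinate system when [C(x_1, ..., x_d) -> L] is an
   isomorphism: the family is algebraically independent over [C] and every
   element of [L] is a quotient of two polynomials in it. *)
Definition birational_coordinates (C L : fieldType) (iota : {rmorphism C -> L})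
    (J : finType) (x : J -> L) : Prop :=
  let ev := fun p : {mpoly C[#|J|]} => mmap iota (fun i => x (enum_val i)) p in
  (forall p, ev p = 0 -> p = 0) /\
  (forall f : L, exists p q, ev q != 0 /\ f = ev p / ev q).

Local Notation tofrac := (@FracField.tofrac _).

(* The extension to fractions of an injective ring morphism [phi]. *)
Definition frac_ext (D : idomainType) (F : fieldType) (phi : D -> F)
    (f : {fraction D}) : F :=
  phi (\n_(repr f)) / phi (\d_(repr f)).

Section FracExt.
Variables (D : idomainType) (F : fieldType) (phi : {rmorphism D -> F}).
Hypothesis phi_inj : injective phi.

Lemma frac_repr (f : {fraction D}) :
  f = tofrac (\n_(repr f)) / tofrac (\d_(repr f)).
Proof.
have d0 := denom_ratioP (repr f).
apply: (canRL (mulfK _)); first by rewrite tofrac_eq0.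
rewrite -{1}[f]reprK; apply/eqP.
rewrite /GRing.mul /= !piE.
rewrite FracField.equivfE /FracField.mulf.
by rewrite !numden_Ratio ?mulr1 ?oner_neq0 //= mulrC.
Qed.

Lemma frac_extE (p q : D) : q != 0 ->
  frac_ext phi (tofrac p / tofrac q) = phi p / phi q.
Proof.
move=> q0; rewrite /frac_ext; set f := (X in repr X).
have d0 := denom_ratioP (repr f).
have := frac_repr f; rewrite {1}/f => /eqP.
rewrite GRing.eqr_div ?tofrac_eq0 // -!tofracM tofrac_eq => /eqP e.
have nz (u : D) : u != 0 -> phi u != 0.
  by move=> u0; rewrite -(rmorph0 phi) (inj_eq phi_inj).
by apply/eqP; rewrite GRing.eqr_div ?nz // -!rmorphM e.
Qed.

Lemma frac_ext_tofrac p : frac_ext phi (tofrac p) = phi p.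
Proof.
have := @frac_extE p 1 (oner_neq0 _).
by rewrite tofrac1 rmorph1 !divr1.
Qed.

Lemma frac_ext1 : frac_ext phi 1 = 1.
Proof. by rewrite -tofrac1 frac_ext_tofrac rmorph1. Qed.

Lemma frac_extB (f g : {fraction D}) :
  frac_ext phi (f - g) = frac_ext phi f - frac_ext phi g.
Proof.
have nz (u : D) : u != 0 -> phi u != 0.
  by move=> u0; rewrite -(rmorph0 phi) (inj_eq phi_inj).
have df := denom_ratioP (repr f); have dg := denom_ratioP (repr g).
rewrite {1}(frac_repr f) {1}(frac_repr g) -mulNr GRing.addf_div ?tofrac_eq0 //.
rewrite -!tofracN -!tofracM -tofracD frac_extE ?mulf_neq0 //.
rewrite /frac_ext -mulNr GRing.addf_div ?nz //.
by rewrite rmorphD !rmorphM rmorphN.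
Qed.

Lemma frac_ext_div (f g : {fraction D}) :
  frac_ext phi (f / g) = frac_ext phi f / frac_ext phi g.
Proof.
have [->|g0] := eqVneq g 0.
  have -> : frac_ext phi 0 = 0 by rewrite -tofrac0 frac_ext_tofrac rmorph0.
  by rewrite !invr0 !mulr0 -tofrac0 frac_ext_tofrac rmorph0.
have df := denom_ratioP (repr f); have dg := denom_ratioP (repr g).
have ng : \n_(repr g) != 0.
  apply: contraNneq g0 => e; by rewrite (frac_repr g) e tofrac0 mul0r.
rewrite {1}(frac_repr f) {1}(frac_repr g) invf_div GRing.mulf_div -!tofracM.
rewrite frac_extE ?mulf_neq0 // /frac_ext invf_div GRing.mulf_div.
by rewrite !rmorphM.
Qed.

End FracExt.

(* The subfield of [F] cut out by a predicate closed under the field operations. *)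
Section Subfield.
Variables (F : fieldType) (P : {pred F}) (hP : divring_closed P).

Definition subfield_pred of divring_closed P : {pred F} := P.
HB.instance Definition _ := GRing.isDivringClosed.Build F (subfield_pred hP) hP.

Record subfield := Subfield {
  subfield_val : F; _ : subfield_val \in subfield_pred hP }.

HB.instance Definition _ := [isSub for subfield_val].
HB.instance Definition _ := [Choice of subfield by <:].
HB.instance Definition _ := [SubChoice_isSubComUnitRing of subfield by <:].
HB.instance Definition _ := [SubComUnitRing_isSubIntegralDomain of subfield by <:].
HB.instance Definition _ := [SubIntegralDomain_isSubField of subfield by <:].

Definition subfield_incl : {rmorphism subfield -> F} := (\val : subfield -> F).

End Subfield.

Section Conf.
Variables (C : fieldType) (k n : nat).

(* The function field of [V^n], where [V = C^k], with coordinates the entries of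
   the generic [k x n] matrix whose columns are the vectors [v_1, ..., v_n]. *)
Definition ratVn : fieldType := {fraction {mpoly C[k * n]}}.

Definition genmx : 'M[{mpoly C[k * n]}]_(k, n) :=
  \matrix_(a, i) 'X_(mxvec_index a i).

Definition subst (M : 'M[{mpoly C[k * n]}]_(k, n)) (p : {mpoly C[k * n]}) :
    {mpoly C[k * n]} :=
  p \mPo [tuple mxvec M 0 i | i < k * n].

HB.instance Definition _ M := GRing.RMorphism.copy (subst M)
  (comp_mpoly [tuple mxvec M 0 i | i < k * n]).

Definition rsubst (M : 'M[{mpoly C[k * n]}]_(k, n)) (f : ratVn) : ratVn :=
  frac_ext (fun p => tofrac (subst M p)) f.

(* [SL_k] acts on [V^n] diagonally and [T^n] by rescaling the vectors. *)
Definition SLmx (g : 'M[C]_k) := map_mx (@mpolyC (k * n) C) g *m genmx.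
Definition Tmx (t : 'rV[C]_n) := genmx *m diag_mx (map_mx (@mpolyC (k * n) C) t).

Lemma subst_genmx M : map_mx (subst M) genmx = M.
Proof.
apply/matrixP => a i; rewrite !mxE /subst comp_mpolyXU -tnth_nth tnth_mktuple.
by rewrite mxvecE.
Qed.

Lemma substC M c : subst M c%:MP = c%:MP.
Proof. exact: comp_mpolyC. Qed.

Lemma subst_mpolyC M m p (A : 'M[C]_(m, p)) :
  map_mx (subst M) (map_mx (@mpolyC (k * n) C) A) = map_mx (@mpolyC _ C) A.
Proof. by apply/matrixP => i j; rewrite !mxE substC. Qed.

Lemma subst_subst_id M N : map_mx (subst N) M = genmx -> cancel (subst M) (subst N).
Proof.
move=> e p; rewrite /subst; rewrite [in RHS](mpolyE p) [X in X \mPo _]comp_mpolyEX.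
rewrite raddf_sum /=; apply: eq_bigr => m _.
rewrite comp_mpolyZ; congr (_ *: _).
rewrite comp_mpolyX rmorph_prod /= [RHS]mpolyXE_id; apply: eq_bigr => i _.
rewrite rmorphXn /= tnth_mktuple; congr (_ ^+ _).
case/mxvec_indexP: i => a i; rewrite mxvecE.
by move/matrixP: e => /(_ a i); rewrite !mxE.
Qed.

Lemma SLmx_inj g : g \in unitmx -> injective (tofrac \o subst (SLmx g)).
Proof.
move=> gu; apply: inj_comp => [p q /eqP|]; first by rewrite tofrac_eq => /eqP.
apply: (can_inj (g := subst (SLmx (invmx g)))); apply: subst_subst_id.
rewrite map_mxM subst_mpolyC subst_genmx /SLmx mulmxA -map_mxM mulmxV //.
by rewrite map_mx1 mul1mx.
Qed.

Lemma Tmx_inj (t : 'rV[C]_n) : (forall i, t 0 i != 0) ->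
  injective (tofrac \o subst (Tmx t)).
Proof.
move=> tu; apply: inj_comp => [p q /eqP|]; first by rewrite tofrac_eq => /eqP.
apply: (can_inj (g := subst (Tmx (map_mx GRing.inv t)))); apply: subst_subst_id.
rewrite map_mxM subst_genmx -!map_diag_mx subst_mpolyC /Tmx -mulmxA.
rewrite -!map_diag_mx -map_mxM.
suff -> : diag_mx (map_mx GRing.inv t) *m diag_mx t = 1%:M.
  by rewrite map_mx1 mulmx1.
rewrite mulmx_diag -diag_const_mx; congr diag_mx.
by apply/rowP => i; rewrite !mxE mulVf.
Qed.

(* [Conf_n V = SL_k \ V^n]: its function field consists of the [SL_k]-invariant
   rational functions on [V^n]. *)
Definition SL_invariant : {pred ratVn} :=
  fun f => `[< forall g : 'M[C]_k, \det g = 1 -> rsubst (SLmx g) f = f >].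

Lemma SL_invariant_divring : divring_closed SL_invariant.
Proof.
have inj (g : 'M[C]_k) : \det g = 1 -> injective (tofrac \o subst (SLmx g)).
  by move=> dg; apply: SLmx_inj; rewrite unitmxE dg unitr1.
split=> [|f h /asboolP fi /asboolP hi|f h /asboolP fi /asboolP hi];
  apply/asboolP => g dg.
- exact: (frac_ext1 (inj g dg)).
- by rewrite [LHS](frac_extB (inj g dg)); congr (_ - _); [exact: fi|exact: hi].
- by rewrite [LHS](frac_ext_div (inj g dg)); congr (_ / _); [exact: fi|exact: hi].
Qed.

Definition ratConfV : fieldType := subfield SL_invariant_divring.

Definition confV_val : {rmorphism ratConfV -> ratVn} :=
  subfield_incl SL_invariant_divring.

(* [Conf_n P^{k-1} = Conf_n V / T^n]: its function field consists of the
   [T^n]-invariant rational functions on [Conf_n V]. *)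
Definition T_invariant : {pred ratConfV} :=
  fun f => `[< forall t : 'rV[C]_n, (forall i, t 0 i != 0) ->
                 rsubst (Tmx t) (confV_val f) = confV_val f >].

Lemma T_invariant_divring : divring_closed T_invariant.
Proof.
split=> [|f h /asboolP fi /asboolP hi|f h /asboolP fi /asboolP hi];
  apply/asboolP => t t0.
- by rewrite rmorph1; exact: (frac_ext1 (Tmx_inj t0)).
- by rewrite rmorphB [LHS](frac_extB (Tmx_inj t0)); congr (_ - _);
    [exact: fi|exact: hi].
- by rewrite fmorph_div [LHS](frac_ext_div (Tmx_inj t0)); congr (_ / _);
    [exact: fi|exact: hi].
Qed.

Definition ratConfP : fieldType := subfield T_invariant_divring.

(* Pullback of rational functions along [p : Conf_n V -> Conf_n P^{k-1}]. *)
Definition pstar : {rmorphism ratConfP -> ratConfV} :=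
  subfield_incl T_invariant_divring.

Lemma constV_subproof (c : C) : tofrac c%:MP \in SL_invariant.
Proof.
apply/asboolP => g dg; have gu : g \in unitmx by rewrite unitmxE dg unitr1.
by rewrite [LHS](frac_ext_tofrac (SLmx_inj gu)) /= substC.
Qed.

Definition constV c : ratConfV := Subfield (hP := SL_invariant_divring) (constV_subproof c).

Lemma constP_subproof (c : C) : constV c \in T_invariant.
Proof.
apply/asboolP => t t0.
by rewrite [LHS](frac_ext_tofrac (Tmx_inj t0)) /= substC.
Qed.

Definition constP c : ratConfP := Subfield (hP := T_invariant_divring) (constP_subproof c).

Lemma constP_zmod : zmod_morphism constP.
Proof. by move=> c d; do 2!apply: val_inj; rewrite /= !rmorphB. Qed.

Lemma constP_monoid : monoid_morphism constP.
Proof. by split=> [|c d]; do 2!apply: val_inj; rewrite /= ?rmorph1 ?rmorphM. Qed.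

HB.instance Definition _ := GRing.isZmodMorphism.Build C ratConfP constP constP_zmod.
HB.instance Definition _ :=
  GRing.isMonoidMorphism.Build C ratConfP constP constP_monoid.

(* The [a]-th coordinate of the vector [v_j], with [j] counted from 1; it is
   only meaningful for [1 <= j <= n]. *)
Definition coord (a : 'I_k) (j : nat) : {mpoly C[k * n]} :=
  oapp (genmx a) 0 (insub j.-1).

(* [P_J] for [J] listed in increasing order. *)
Definition plucker_poly (J : seq nat) : {mpoly C[k * n]} :=
  \det (\matrix_(a < k, c < k) coord a (nth 0%N J c)).

Lemma plucker_subproof J : tofrac (plucker_poly J) \in SL_invariant.
Proof.
apply/asboolP => g dg; have gu : g \in unitmx by rewrite unitmxE dg unitr1.
rewrite [LHS](frac_ext_tofrac (SLmx_inj gu)) /=; congr tofrac.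
rewrite /plucker_poly -det_map_mx /=.
set N := \matrix_(a, c) _.
suff -> : map_mx (subst (SLmx g)) N = map_mx (@mpolyC (k * n) C) g *m N.
  by rewrite det_mulmx det_map_mx dg /= mpolyC1 mul1r.
have NE b c : N b c = oapp (genmx b) 0 (insub (nth 0%N J c).-1) by rewrite mxE.
apply/matrixP => a c; rewrite [LHS]mxE [RHS]mxE NE.
under eq_bigr => b _ do rewrite NE.
case: (insub _) => [j|] /=; last first.
  by rewrite rmorph0 big1 // => b _; rewrite mulr0.
by have /matrixP /(_ a j) := subst_genmx (SLmx g); rewrite mxE => ->; rewrite mxE.
Qed.

Definition plucker (J : seq nat) : ratConfV := Subfield (hP := SL_invariant_divring) (plucker_subproof J).

End Conf.

Section InitialSeed.
Variables (k n : nat).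

(* [None] is the vertex [*]; [Some (b', e')] is the vertex [(b, e)] with
   [b = b' + 1] in [1..k] and [e = e' + k + 1] in [k+1..n]. *)
Definition vertex : finType := option ('I_k * 'I_(n - k))%type.

Definition row_of (v : 'I_k * 'I_(n - k)) : nat := v.1.+1.
Definition col_of (v : 'I_k * 'I_(n - k)) : nat := (v.2 + k).+1.

Definition frozen : {set vertex} :=
  [set v : vertex |
    if v is Some w then (row_of w == k) || (col_of w == n) else true].

Definition arrow (u v : vertex) : bool :=
  match u, v with
  | Some u, Some v =>
      let b := row_of u in let e := col_of u in
      let b' := row_of v in let e' := col_of v in
      [|| [&& (b < k)%N, b' == b & e' == e.+1],
          (b' == b.+1) && (e' == e) |
          (b == b'.+1) && (e == e'.+1)]
  | None, Some v => (row_of v == 1%N) && (col_of v == k.+1)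
  | _, None => false
  end.

(* [b_ij > 0] is the number of arrows from [j] to [i]. *)
Definition init_exch (i j : vertex) : int := (arrow j i)%:Z - (arrow i j)%:Z.

Lemma init_exch_skew i j : init_exch i j = - init_exch j i.
Proof. by rewrite /init_exch opprB. Qed.

Definition init_label (v : vertex) : seq nat :=
  if v is Some w then
    iota 1 (k - row_of w) ++ iota (col_of w - row_of w).+1 (row_of w)
  else iota 1 k.

Definition initial_seed (C : fieldType) : seed vertex (ratConfV C k n) :=
  Seed init_exch_skew (fun v => plucker C k n (init_label v)).

Definition seed_of_ConfV (C : fieldType) (S : seed vertex (ratConfV C k n)) : Prop :=
  mutation_equivalent frozen (initial_seed C) S.

(* A family [X] of rational functions on [Conf_n P^{k-1}], one for each seed and
   each unfrozen index. *)
Definition X_family (C : fieldType) :=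
  seed vertex (ratConfV C k n) -> unfrozen frozen -> ratConfP C k n.

Definition cluster_X_structure (C : fieldType) (X : X_family C) : Prop :=
  forall S, seed_of_ConfV S ->
    birational_coordinates (@constP C k n) (X S) /\
    (forall m i : unfrozen frozen,
       X (mutate (val m) S) i = mutX (exch S) (X S) m i).

Definition cluster_ensemble (C : fieldType) (X : X_family C) : Prop :=
  forall S, seed_of_ConfV S -> forall i : unfrozen frozen,
    pstar C k n (X S i) = \prod_j clvar S j ^ exch S (val i) j.

End InitialSeed.

(* Main.v *)
Require Import Defs.
From HB Require Import structures.
From mathcomp Require Import all_boot all_order all_algebra.
From mathcomp Require Import boolp reals complex mpoly.
From mathcomp Require Import perm ring zify.

(* The monomials [prod_j A_j^(B_ij)] transform by X-mutation whenever the cluster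
   variables transform by A-mutation, and X-mutation is an involution up to the sign
   of the exchange matrix, so it preserves birational coordinate systems; hence
   everything reduces to the initial seed. There the monomial at [(b, e)] is a ratio
   of six minors which is invariant under rescaling the vectors.
   Independence: prescribing nonzero values of these ratios, one finds nonzero values
   of all initial minors, and then a matrix having these minors, column by column, as
   the equations for a column are triangular with earlier minors on the diagonal. So
   the ratios specialise to independent variables.
   Generation: over the field of rational functions of the generic matrix [G], [GL_k]
   and the torus bring [G] to a normal form whose entries are, by the same triangular
   recursion, rational in the ratios. An invariant function takes the same value
   at [G] and at its normal form: invariance under complex points extends to points over
   the function field by Zariski density. *)

Set Implicit Arguments.
Unset Strict Implicit.
Unset Printing Implicit Defensive.

Import Order.TTheory GRing.Theory Num.Theory.
Local Open Scope ring_scope.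

Local Notation tofrac := (@FracField.tofrac _).

(** * Specialisation, generated subfields and algebraic independence *)

Lemma rmorph_mmap (n : nat) (R S T : comNzRingType) (h : {rmorphism S -> T})
    (f : {rmorphism R -> S}) (x : 'I_n -> S) (p : {mpoly R[n]}) :
  h (mmap f x p) = mmap (h \o f) (h \o x) p.
Proof.
rewrite /mmap rmorph_sum; apply: eq_bigr => m _; rewrite rmorphM.
by rewrite /mmap1 rmorph_prod; congr (_ * _); apply: eq_bigr => i _; rewrite rmorphXn.
Qed.

Lemma eq_mmap (n : nat) (R S : comNzRingType) (f g : R -> S) (x y : 'I_n -> S)
    (p : {mpoly R[n]}) : f =1 g -> x =1 y -> mmap f x p = mmap g y p.
Proof.
by move=> fg xy; apply: eq_bigr => m _; rewrite fg (mmap1_eq m xy).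
Qed.

Lemma tofrac_inj (D : idomainType) : injective (@FracField.tofrac D).
Proof. by move=> p q /eqP; rewrite tofrac_eq => /eqP. Qed.

Section Specialisation.
Variables (D : comNzRingType) (L F : fieldType).
Variables (iota : {rmorphism D -> L}) (phi : {rmorphism D -> F}).
Hypothesis iota_inj : injective iota.

(* [phi] extends to a partial map on fractions: [spec f v] says that [f] has the
   value [v]. *)
Definition spec (f : L) (v : F) : Prop :=
  exists a b, [/\ phi b != 0, f = iota a / iota b & v = phi a / phi b].

Lemma iota_neq0 b : phi b != 0 -> iota b != 0.
Proof.
by apply: contra_neq => /eqP; rewrite -(rmorph0 iota) (inj_eq iota_inj) => /eqP ->;
  rewrite rmorph0.
Qed.

Lemma spec_iota a : spec (iota a) (phi a).
Proof. by exists a, 1; rewrite !rmorph1 !divr1 oner_neq0. Qed.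

Lemma specD f g v w : spec f v -> spec g w -> spec (f + g) (v + w).
Proof.
move=> [a [b [b0 -> ->]]] [c [d [d0 -> ->]]].
exists (a * d + c * b), (b * d); rewrite !rmorphM !rmorphD !rmorphM mulf_neq0 //.
by rewrite !GRing.addf_div ?iota_neq0.
Qed.

Lemma specM f g v w : spec f v -> spec g w -> spec (f * g) (v * w).
Proof.
move=> [a [b [b0 -> ->]]] [c [d [d0 -> ->]]].
by exists (a * c), (b * d); rewrite !rmorphM mulf_neq0 // !GRing.mulf_div.
Qed.

Lemma specV f v : v != 0 -> spec f v -> spec f^-1 v^-1.
Proof.
move=> v0 [a [b [b0 fE vE]]]; exists b, a; rewrite fE vE !invf_div; split=> //.
by move: v0; rewrite vE mulf_eq0 negb_or => /andP[].
Qed.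

(** Injectivity of [iota] makes the value of 0 unambiguous, so a polynomial relation between
    elements of [L] passes to their values. *)
Lemma spec0 v : spec 0 v -> v = 0.
Proof.
move=> [a [b [b0 /esym/eqP + ->]]].
rewrite mulf_eq0 invr_eq0 (negPf (iota_neq0 b0)) orbF -(rmorph0 iota).
by rewrite (inj_eq iota_inj) => /eqP ->; rewrite rmorph0 mul0r.
Qed.

Lemma spec_sum (I : Type) (r : seq I) (P : pred I) (f : I -> L) (v : I -> F) :
  (forall i, P i -> spec (f i) (v i)) ->
  spec (\sum_(i <- r | P i) f i) (\sum_(i <- r | P i) v i).
Proof.
move=> fv; apply: big_ind2 => //; last by move=> ? ? ? ?; apply: specD.
by have := spec_iota 0; rewrite !rmorph0.
Qed.

Lemma spec1 : spec 1 1.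
Proof. by have := spec_iota 1; rewrite !rmorph1. Qed.

Lemma spec_prod (I : Type) (r : seq I) (P : pred I) (f : I -> L) (v : I -> F) :
  (forall i, P i -> spec (f i) (v i)) ->
  spec (\prod_(i <- r | P i) f i) (\prod_(i <- r | P i) v i).
Proof.
move=> fv; apply: big_ind2 => //; first exact: spec1.
by move=> ? ? ? ?; apply: specM.
Qed.

Lemma specX f v m : spec f v -> spec (f ^+ m) (v ^+ m).
Proof.
move=> fv; elim: m => [|m IH]; first exact: spec1.
by rewrite !exprS; apply: specM.
Qed.

Lemma spec_exprz f v (z : int) : v != 0 -> spec f v -> spec (f ^ z) (v ^ z).
Proof.
move=> v0 fv; case: z => m; first exact: specX.
by apply: specV; [rewrite expf_neq0|apply: specX].
Qed.

Lemma spec_mmap (C : comNzRingType) (n : nat) (f : C -> L) (g : C -> F)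
    (x : 'I_n -> L) (y : 'I_n -> F) (p : {mpoly C[n]}) :
  (forall c, spec (f c) (g c)) -> (forall i, spec (x i) (y i)) ->
  spec (mmap f x p) (mmap g y p).
Proof.
move=> fg xy; apply: spec_sum => m _; apply: specM => //.
by apply: spec_prod => i _; apply: specX.
Qed.

End Specialisation.

Section Generation.
Variables (C L : fieldType) (iota : {rmorphism C -> L}) (n : nat) (x : 'I_n -> L).

Let ev := mmap iota x.

Definition generated_field : {pred L} :=
  fun f => `[< exists p q : {mpoly C[n]}, ev q != 0 /\ f = ev p / ev q >].

Lemma genP f : reflect (exists p q, ev q != 0 /\ f = ev p / ev q) (f \in generated_field).
Proof. exact: asboolP. Qed.

Lemma gen_ev p : ev p \in generated_field.
Proof. by apply/genP; exists p, 1; rewrite /ev rmorph1 divr1 oner_neq0. Qed.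

Lemma gen_divring : divring_closed generated_field.
Proof.
split=> [|f g /genP[p [q [q0 ->]]] /genP[r [s [s0 ->]]]
  |f g /genP[p [q [q0 ->]]] /genP[r [s [s0 ->]]]].
- by have := gen_ev 1; rewrite /ev rmorph1.
- apply/genP; exists (p * s - r * q), (q * s).
  rewrite /ev rmorphB !rmorphM mulf_neq0 //; split=> //.
  by rewrite -[- (_ / _)]mulNr GRing.addf_div // mulNr.
- have [r0|r0] := eqVneq (ev r) 0.
    by rewrite r0 mul0r invr0 mulr0 -(rmorph0 ev); apply: gen_ev.
  apply/genP; exists (p * s), (q * r); rewrite /ev !rmorphM mulf_neq0 //.
  by rewrite invf_div GRing.mulf_div.
Qed.

Lemma gen_const c : iota c \in generated_field.
Proof. by have := gen_ev c%:MP; rewrite /ev mmapC. Qed.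

Lemma gen_var i : x i \in generated_field.
Proof. by have := gen_ev 'X_i; rewrite /ev mmapX mmap1U. Qed.

Lemma mmap_subfield (P : {pred L}) (hP : divring_closed P) p :
  (forall c, iota c \in P) -> (forall i, x i \in P) -> ev p \in P.
Proof.
(* The predicate [subfield_pred hP] is [P] itself, but it carries the closure structure on which the
   [rpred] lemmas rely; the same change of form recurs below. *)
move=> cP xP; suff : ev p \in subfield_pred hP by [].
apply: rpred_sum => m _; apply: rpredM; first exact: cP.
by apply: rpred_prod => i _; apply: rpredX; apply: xP.
Qed.

End Generation.

Lemma gen_trans (C L : fieldType) (iota : {rmorphism C -> L}) (n m : nat)
    (x : 'I_n -> L) (y : 'I_m -> L) f :
  (forall i, x i \in generated_field iota y) -> f \in generated_field iota x ->
  f \in generated_field iota y.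
Proof.
move=> xy /genP[p [q [_ ->]]].
have ev_in r : mmap iota x r \in generated_field iota y.
  by apply: mmap_subfield => //; [exact: gen_divring | exact: gen_const].
suff : mmap iota x p / mmap iota x q \in subfield_pred (gen_divring iota y) by [].
by apply: rpred_div; apply: ev_in.
Qed.

Section AlgIndep.
Variables (C L : fieldType) (iota : {rmorphism C -> L}) (J : finType).

Definition genvar (i : J) : {fraction {mpoly C[#|J|]}} :=
  tofrac 'X_(enum_rank i).

Definition genconst : {rmorphism C -> {fraction {mpoly C[#|J|]}}} :=
  tofrac \o @mpolyC #|J| C.

Lemma genvar_neq0 i : genvar i != 0.
Proof.
rewrite /genvar tofrac_eq0; apply/negP => /eqP /(congr1 (meval (fun _ => 1))).
by rewrite mevalXU meval0 => /eqP; rewrite oner_eq0.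
Qed.

Lemma genvar_neqN1 i : 1 + genvar i != 0.
Proof.
rewrite /genvar -tofrac1 -tofracD tofrac_eq0.
apply/negP => /eqP /(congr1 (meval (fun _ => 0))).
by rewrite mevalD meval1 mevalXU meval0 addr0 => /eqP; rewrite oner_eq0.
Qed.

Lemma mmap_genvar p : mmap genconst (fun i => genvar (enum_val i)) p = tofrac p.
Proof.
rewrite [in RHS](mpolyE p) rmorph_sum; apply: eq_bigr => m _.
rewrite -mul_mpolyC rmorphM; congr (_ * _).
rewrite [in RHS]mpolyXE_id rmorph_prod; apply: eq_bigr => i _.
by rewrite /= rmorphXn /genvar enum_valK.
Qed.

(** A relation [p] between the [x i] specialises to [p] evaluated at independent variables, which is
    [p] itself seen as a fraction. *)
Lemma spec_alg_indep (D : comNzRingType) (io : {rmorphism D -> L})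
    (phi : {rmorphism D -> {fraction {mpoly C[#|J|]}}}) (x : J -> L) :
  injective io -> (forall c, spec io phi (iota c) (genconst c)) ->
  (forall i, spec io phi (x i) (genvar i)) ->
  forall p : {mpoly C[#|J|]}, mmap iota (fun i => x (enum_val i)) p = 0 -> p = 0.
Proof.
move=> io_inj sc sx p p0.
have sx' (i : 'I_#|J|) := sx (enum_val i).
have := spec_mmap io_inj p sc sx'; rewrite mmap_genvar p0 => /(spec0 io_inj)/eqP.
by rewrite tofrac_eq0 => /eqP.
Qed.

Lemma birationalE (x : J -> L) : birational_coordinates iota x <->
  (forall p : {mpoly C[#|J|]}, mmap iota (fun i => x (enum_val i)) p = 0 -> p = 0) /\
  (forall f, f \in generated_field iota (fun i : 'I_#|J| => x (enum_val i))).
Proof.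
split=> -[ind g]; split=> // f; first by apply/genP; apply: g.
by apply/genP.
Qed.

End AlgIndep.

(** * X-mutation and birational coordinate systems *)

Section MutX.
Variables (I : finType) (fr : {set I}).
Implicit Types (b : I -> I -> int) (m i : unfrozen fr).

(** Writing X for [x m], the identities 1 + X^-1 = (1 + X) X^-1 and max(0, z) - max(0, -z) = z make
    the factors of the two mutations cancel. *)
Lemma mutX_involutive (F : fieldType) b b' (x : unfrozen fr -> F) m :
  (forall i, b' (val i) (val m) = - b (val i) (val m)) ->
  x m != 0 -> 1 + x m != 0 -> mutX b' (mutX b x m) m =1 x.
Proof.
move=> bb x0 x1 i; rewrite /mutX !eqxx; case: (eqVneq i m) => [->|_].
  by rewrite invrK.
rewrite bb opprK; set z := b _ _.
have -> : 1 + (x m)^-1 = (1 + x m) * (x m)^-1 by rewrite mulrDl mulfV // mul1r addrC.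
rewrite expfzMl !exprz_inv.
have e1 : (1 + x m) ^ (- z) * (1 + x m) ^ z = 1 by rewrite -expfzDr // addNr.
have e2 : x m ^ Num.max 0 z * x m ^ (- Num.max 0 (- z)) * x m ^ (- z) = 1.
  rewrite -!expfzDr //.
  have -> : Num.max 0 z - Num.max 0 (- z) - z = 0; last by rewrite expr0z.
  by case: (lerP 0 z) => h; case: (lerP 0 (- z)) => h'; lia.
move: (_ ^ (- z)) ((1 + x m) ^ z) (_ ^ Num.max 0 z) (_ ^ (- Num.max _ _)) (x m ^ (- z)) e1 e2.
move=> p q r s t pq rst; rewrite -[RHS]mulr1 -{1}pq -[RHS]mulr1 -{1}rst; ring.
Qed.

Lemma spec_mutX (D : comNzRingType) (L F : fieldType) (iota : {rmorphism D -> L})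
    (phi : {rmorphism D -> F}) b (x : unfrozen fr -> L) (y : unfrozen fr -> F) m :
  injective iota -> (forall i, spec iota phi (x i) (y i)) ->
  y m != 0 -> 1 + y m != 0 ->
  forall i, spec iota phi (mutX b x m i) (mutX b y m i).
Proof.
move=> inj xy y0 y1 i; rewrite /mutX; case: ifP => _; first exact: specV.
apply: specM; first by apply: specM => //; apply: spec_exprz.
by apply: spec_exprz => //; apply: specD => //; apply: spec1.
Qed.

Lemma rmorph_mutX (L F : fieldType) (h : {rmorphism L -> F}) b (x : unfrozen fr -> L) m i :
  h (mutX b x m i) = mutX b (h \o x) m i.
Proof.
rewrite /mutX; case: ifP => _; first exact: fmorphV.
by rewrite !rmorphM !fmorphXz rmorphD rmorph1.
Qed.

Lemma mutX_subfield (L : fieldType) (P : {pred L}) (hP : divring_closed P) b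
    (x : unfrozen fr -> L) m :
  (forall i, x i \in P) -> forall i, mutX b x m i \in P.
Proof.
move=> xP i; suff : mutX b x m i \in subfield_pred hP by [].
have xP' j : x j \in subfield_pred hP by apply: xP.
rewrite /mutX; case: ifP => _; first by rewrite rpredV.
have zP (u : L) (z : int) : u \in subfield_pred hP -> u ^ z \in subfield_pred hP.
  by case: z => c uP /=; rewrite ?rpredV rpredX.
by rewrite !rpredM ?zP ?rpredD ?rpred1.
Qed.

End MutX.

Section Birational.
Variables (C L : fieldType) (iota : {rmorphism C -> L}).

(** Used for the constants 0 and -1, which must be avoided for an X-mutation to be invertible. *)
Lemma birational_neqC (J : finType) (x : J -> L) i c :
  birational_coordinates iota x -> x i != iota c.
Proof.
case=> ind _; rewrite -subr_eq0; apply/eqP => e.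
have : 'X_(enum_rank i) - c%:MP = 0 :> {mpoly C[#|J|]}.
  by apply: ind; rewrite /= rmorphB /= mmapX mmap1U mmapC enum_rankK.
(* The polynomial X - c takes the value 1 at c + 1. *)
move/(congr1 (meval (fun _ => c + 1))); rewrite mevalB mevalXU mevalC meval0.
by move/eqP; rewrite addrAC subrr add0r oner_eq0.
Qed.

(** Mutating back with the matrix [- b] recovers [x], so the mutated family generates [L] as well.
    For independence, [x] is specialised to the family whose mutation consists of the independent
    variables. *)
Lemma birational_mutX (I : finType) (fr : {set I}) (b : I -> I -> int)
    (x : unfrozen fr -> L) m :
  birational_coordinates iota x -> birational_coordinates iota (mutX b x m).
Proof.
move=> bir; have [ind xgen] := (birationalE iota x).1 bir.
have x0 : x m != 0 by rewrite -(rmorph0 iota); apply: birational_neqC.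
have x1 : 1 + x m != 0.
  by rewrite addrC -[1]opprK subr_eq0 -(rmorph1 iota) -rmorphN birational_neqC.
pose J : finType := unfrozen fr; pose x' := mutX b x m.
pose b' i j := - b i j.
have x'K : mutX b' x' m =1 x by apply: mutX_involutive.
apply/(birationalE iota x'); split; last first.
  move=> f; apply: gen_trans (xgen f) => i; rewrite -x'K.
  apply: mutX_subfield; first exact: gen_divring.
  by move=> j; have := gen_var iota (fun i : 'I_#|J| => x' (enum_val i)) (enum_rank j);
    rewrite enum_rankK.
pose ev : {rmorphism {mpoly C[#|J|]} -> L} := mmap iota (fun i => x (enum_val i)).
have ev_inj : injective ev.
  by move=> p q /eqP; rewrite -subr_eq0 -rmorphB => /eqP /ind /eqP; rewrite subr_eq0 => /eqP.
pose T := @genvar C J; pose y := mutX b' T m.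
(* Since [x] is independent, [ev] embeds the polynomial ring into [L]; giving its variables the
   values [y] therefore specialises [x] to [y]. *)
pose phi : {rmorphism {mpoly C[#|J|]} -> {fraction {mpoly C[#|J|]}}} :=
  mmap (genconst C J) (fun i => y (enum_val i)).
have phiC c : spec ev phi (iota c) (genconst C J c).
  have -> : iota c = ev c%:MP by rewrite /ev /= mmapC.
  have -> : genconst C J c = phi c%:MP by rewrite /phi /= mmapC.
  exact: spec_iota.
apply: (spec_alg_indep ev_inj phiC) => i.
have T0 := @genvar_neq0 C J m.
have T1 := @genvar_neqN1 C J m.
have yK : mutX b y m =1 T.
  by apply: mutX_involutive; [move=> j; rewrite /b' opprK | exact: T0 | exact: T1].
have yE j : y j = phi 'X_(enum_rank j) by rewrite /phi /= mmapX mmap1U enum_rankK.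
have ym : y m = (T m)^-1 by rewrite /y /mutX eqxx.
have sxy j : spec ev phi (x j) (y j).
  have -> : x j = ev 'X_(enum_rank j) by rewrite /ev /= mmapX mmap1U enum_rankK.
  by rewrite yE; apply: spec_iota.
have y0 : y m != 0 by rewrite ym invr_eq0; exact: T0.
have y1 : 1 + y m != 0.
  rewrite ym -(mulfV T0) -[X in _ + X]mul1r -mulrDl [T m + 1]addrC.
  by apply: mulf_neq0; [exact: T1 | rewrite invr_eq0; exact: T0].
have := spec_mutX b ev_inj sxy y0 y1 i.
by rewrite yK.
Qed.

(** Both defining properties are tested after the embedding [kappa], so that functions on a quotient
    can be handled as functions on the space of matrices. *)
Lemma birational_embed (K : fieldType) (kappa : {rmorphism L -> K}) (J : finType)
    (x : J -> L) (h : {rmorphism C -> K}) (y : J -> K) :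
  (forall c, kappa (iota c) = h c) -> (forall i, kappa (x i) = y i) ->
  (forall p : {mpoly C[#|J|]}, mmap h (fun i => y (enum_val i)) p = 0 -> p = 0) ->
  (forall f, kappa f \in generated_field h (fun i : 'I_#|J| => y (enum_val i))) ->
  birational_coordinates iota x.
Proof.
move=> hE yE ind yg.
have E (p : {mpoly C[#|J|]}) : kappa (mmap iota (fun i => x (enum_val i)) p) =
    mmap h (fun i => y (enum_val i)) p.
  by rewrite rmorph_mmap; apply: eq_mmap => [c|i] /=.
split=> [p p0|f]; first by apply: ind; rewrite -E p0 rmorph0.
have /genP[p [q [q0 fE]]] := yg f; exists p, q; split.
  by rewrite -(fmorph_eq0 kappa) E.
by apply: (fmorph_inj kappa); rewrite fE fmorph_div !E.
Qed.

End Birational.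

(** * Exchange monomials under mutation of seeds *)

Section SeedMonomial.
Variables (I : finType) (F : fieldType).
Implicit Types S : seed I F.

Definition xmono S (i : I) : F := \prod_j clvar S j ^ exch S i j.

Lemma exch_diag S m : exch S m m = 0.
Proof. by have := exch_skew S m m; lia. Qed.

Lemma prod_expz (b : I -> int) (A : I -> F) (c : int) :
  (\prod_j A j ^ b j) ^ c = \prod_j A j ^ (b j * c).
Proof.
elim/big_ind2: _ => [|x u y v <- <-|j _]; first by rewrite exp1rz.
  by rewrite expfzMl.
by rewrite exprz_exp.
Qed.

(** The product over the negative exponents is pulled out of the exchange binomial; what remains is
    1 plus the monomial of [m]. *)
Lemma clvar_mutate S m : (forall j, clvar S j != 0) ->
  clvar (mutate m S) m =
    (clvar S m)^-1 * (1 + xmono S m) * \prod_j clvar S j ^ Num.max 0 (- exch S m j).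
Proof.
move=> A0; rewrite /= /mutA eqxx -mulrA; congr (_ * _).
rewrite mulrDl mul1r addrC; congr (_ + _).
  rewrite big_mkcond; apply: eq_bigr => j _.
  by case: ltrP => h; [rewrite max_r // oppr_ge0 ltW | rewrite max_l ?oppr_le0].
rewrite /xmono -big_split big_mkcond; apply: eq_bigr => j _ /=.
rewrite -expfzDr //; case: ltrP => h.
  by rewrite max_l ?addr0 // oppr_le0 ltW.
by rewrite max_r ?oppr_ge0 // addrN.
Qed.

Lemma clvar_mutate_neq0 S m : (forall j, clvar S j != 0) -> 1 + xmono S m != 0 ->
  forall j, clvar (mutate m S) j != 0.
Proof.
move=> A0 X1 j; case: (eqVneq j m) => [->|jm]; last by rewrite /= /mutA (negPf jm).
rewrite clvar_mutate // !mulf_neq0 ?invr_eq0 //.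
by apply/prodf_neq0 => i _; rewrite expfz_neq0.
Qed.

(** For i = m the exponents change sign and the new variable has exponent 0. Otherwise the new
    variable has exponent [- exch S i m] and produces the power of [1 + xmono S m]; the other
    exponents agree by the rule for matrix mutation. *)
Lemma xmono_mutate S m i : (forall j, clvar S j != 0) -> 1 + xmono S m != 0 ->
  xmono (mutate m S) i =
    if i == m then (xmono S m)^-1
    else xmono S i * xmono S m ^ Num.max 0 (exch S i m)
         * (1 + xmono S m) ^ (- exch S i m).
Proof.
move=> A0 X1; have bmm := exch_diag S m.
case: (eqVneq i m) => [->|im].
  rewrite /xmono -prodfV; apply: eq_bigr => j _.
  rewrite /= /mutB eqxx /= /mutA invr_expz.
  by case: eqVneq => [->|_] //; rewrite bmm oppr0 !expr0z.
rewrite [LHS](bigD1 m) //=.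
have -> : mutB (exch S) m i m = - exch S i m by rewrite /mutB eqxx orbT.
have := clvar_mutate m A0 => /= ->.
rewrite !expfzMl exprz_inv opprK -[\prod_(i0 | _) _]mul1r.
set c := exch S i m.
(* The claim with the common power of [1 + xmono S m] removed. *)
suff E : clvar S m ^ c * (\prod_j clvar S j ^ Num.max 0 (- exch S m j)) ^ (- c) *
    \prod_(j | j != m) mutA (exch S) (clvar S) m j ^ mutB (exch S) m i j =
    xmono S i * xmono S m ^ Num.max 0 c.
  rewrite -E mul1r -!mulrA; congr (_ * _).
  by rewrite mulrC -!mulrA; congr (_ * _); rewrite mulrC.
rewrite !prod_expz -big_split /= [X in _ * X * _](bigD1 m) //= [RHS](bigD1 m) //=.
rewrite bmm oppr0 maxxx !mul0r expr0z mul1r mulr1 -mulrA -big_split /=.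
congr (_ * _); apply: eq_bigr => j jm.
rewrite /mutA (negPf jm) -!expfzDr //; congr (_ ^ _).
rewrite /mutB (negPf im) (negPf jm) /= -/c.
(* It remains to compare exponents: with w' the mutated entry, w' - v max(0, -u) = w + u max(0, v),
   checked by the signs of u and v. *)
move: (exch S m j) c (exch S i j) => u v w; clear.
case: (ltrgt0P u) => hu; case: (ltrgt0P v) => hv;
  rewrite ?hu ?hv ?(mulr0, mul0r, oppr0, normr0, lexx, addr0, add0r, maxxx) ?normr0 //.
- rewrite (lt_geF (mulr_gt0 hv hu)) max_l ?max_r ?oppr_le0 ?ltW // //; ring.
- rewrite ltW ?nmulr_rlt0 // max_l ?max_l ?oppr_le0 ?ltW //; ring.
- rewrite ltW ?pmulr_rlt0 // max_r ?max_r ?oppr_ge0 ?ltW //; ring.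
- rewrite nmulr_rle0 // (lt_geF hu) max_r ?max_l ?oppr_ge0 ?ltW // //; ring.
Qed.

Lemma xmono_mutateX (fr : {set I}) S (m i : unfrozen fr) :
  (forall j, clvar S j != 0) -> 1 + xmono S (val m) != 0 ->
  xmono (mutate (val m) S) (val i) = mutX (exch S) (fun j => xmono S (val j)) m i.
Proof. by move=> A0 X1; rewrite xmono_mutate // /mutX (inj_eq val_inj). Qed.

End SeedMonomial.

(** * Minors of a matrix and the normal form of a configuration *)

Section Minors.
Variables (L : fieldType) (k : nat).
Implicit Types (V : nat -> 'I_k -> L) (p : nat -> nat -> L).

(* With columns counted from [0], the columns of [P_{b,k+j}] are [minor_col b j c]
   for [c < k]; for [b = 0] or [j = 0] they are those of [P_*]. *)
Definition minor_col (b j c : nat) : nat := (c + (k - b <= c) * j)%N.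

Definition minor V b j : L := \det (\matrix_(a < k, c < k) V (minor_col b j c) a).

Lemma eq_minor V V' b j :
  (forall i, (i < k + j)%N -> V i =1 V' i) -> minor V b j = minor V' b j.
Proof.
move=> VV; congr (\det _); apply/matrixP => a c; rewrite !mxE VV //.
rewrite /minor_col; have := ltn_ord c; case: (k - b <= c)%N => /=; lia.
Qed.

Lemma minor_row0 V j : minor V 0 j = minor V 0 0.
Proof.
congr (\det _); apply/matrixP => a c; rewrite !mxE; congr (V _ _).
by rewrite /minor_col subn0 leqNgt ltn_ord.
Qed.

Lemma minor_col0 V b : minor V b 0 = minor V 0 0.
Proof.
congr (\det _); apply/matrixP => a c; rewrite !mxE; congr (V _ _).
by rewrite /minor_col !muln0.
Qed.

Lemma minor_mull (g : 'M_k) V b j :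
  minor (fun i a => \sum_d g a d * V i d) b j = \det g * minor V b j.
Proof.
rewrite -det_mulmx; congr (\det _); apply/matrixP => a c; rewrite !mxE.
by apply: eq_bigr => d _; rewrite mxE.
Qed.

Lemma minor_scale (t : nat -> L) V b j :
  minor (fun i a => V i a * t i) b j =
  minor V b j * \prod_(c < k) t (minor_col b j c).
Proof.
transitivity (minor V b j * \det (diag_mx (\row_(c < k) t (minor_col b j c)))).
  rewrite -det_mulmx; congr (\det _); apply/matrixP => a c.
  by rewrite mul_mx_diag !mxE.
by rewrite det_diag; congr (_ * _); apply: eq_bigr => c _; rewrite mxE.
Qed.

(** The columns of the minor are the integers in [0, k - b) and in [k + j - b, k + j). The product
    over the second interval is a quotient of two initial products, whose denominator is cleared
    here. *)
Lemma prod_minor_col (t : nat -> L) b j : (b <= k)%N ->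
  \prod_(c < k) t (minor_col b j c) * \prod_(i < k + j - b) t i =
  \prod_(i < k - b) t i * \prod_(i < k + j) t i.
Proof.
move=> bk; rewrite -!(big_mkord xpredT t) -(big_mkord xpredT (fun c => t (minor_col b j c))).
rewrite (big_cat_nat (n := (k - b)%N)) ?leq_subr //=.
rewrite (big_cat_nat (n := (k + j - b)%N) (p := (k + j)%N)) ?leq_subr //=.
rewrite -mulrA; congr (_ * _); first last.
  rewrite mulrC; congr (_ * _).
  rewrite (_ : (k + j - b = k - b + j)%N); last lia.
  rewrite big_addn; have -> : (k + j - j = k)%N by lia.
  by apply: eq_big_nat => i /andP[h _]; rewrite /minor_col h mul1n.
by apply: eq_big_nat => i /andP[_ h]; rewrite /minor_col leqNgt h addn0.
Qed.

(* For [p = minor V] this is the X-coordinate at the vertex [(b + 1, k + j + 1)]. *)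
Definition Xratio p b j : L :=
  p b.+1 j * p b j.+1 * p b.+2 j.+2 / (p b.+1 j.+2 * p b.+2 j.+1 * p b j).

(** By [prod_minor_col] the weight of the minor (b, j) is h(k - b) h(k + j) / h(k + j - b), where
    h(m) is the product of the first m scalars. The three kinds of factors cancel separately:
    numerator and denominator of [Xratio] show the same values of b, of j and of j - b. *)
Lemma Xratio_scale (t : nat -> L) p b j : (b.+2 <= k)%N -> (forall i, t i != 0) ->
  Xratio (fun b j => p b j * \prod_(c < k) t (minor_col b j c)) b j = Xratio p b j.
Proof.
move=> bk t0.
have h0 m : \prod_(i < m) t i != 0 by apply/prodf_neq0.
pose h m := \prod_(i < m) t i.
have w b' j' : (b' <= b.+2)%N -> \prod_(c < k) t (minor_col b' j' c) =
    h (k - b')%N * h (k + j')%N / h (k + j' - b')%N.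
  move=> b'b; have b'k := leq_trans b'b bk.
  by rewrite -(prod_minor_col t j' b'k) mulfK // h0.
rewrite /Xratio !w ?leqnSn ?leqnn ?(leqW (leqnSn b)) //.
rewrite !addnS !subSS.
have := h0; rewrite -/h => {}h0.
set W1 := h _ * h _ / h _; set W2 := h _ * h _ / h _; set W3 := h _ * h _ / h _.
set W4 := h _ * h _ / h _; set W5 := h _ * h _ / h _; set W6 := h _ * h _ / h _.
have WW : W1 * W2 * W3 = W4 * W5 * W6.
  rewrite /W1 /W2 /W3 /W4 /W5 /W6.
  by field; rewrite !h0.
have W0 : W4 * W5 * W6 != 0 by rewrite !mulf_eq0 !invr_eq0 !(negPf (h0 _)).
transitivity ((p b.+1 j * p b j.+1 * p b.+2 j.+2) * (W1 * W2 * W3) /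
  ((p b.+1 j.+2 * p b.+2 j.+1 * p b j) * (W4 * W5 * W6))).
  by congr (_ / _); ring.
by rewrite WW -mulf_div divff ?mulr1.
Qed.

Definition standard V := forall i (a : 'I_k), (i < k)%N -> V i a = (i == a)%:R.

Variable last : 'I_k.
Hypothesis lastE : last = k.-1 :> nat.

(** The vector [V (k + j)] is the last column of the minor (b + 1, j + 1); these cofactors are the
    coefficients of the linear equation that the minor imposes on it. *)
Definition lead_cof V b j (a : 'I_k) : L :=
  cofactor (\matrix_(a < k, c < k) V (minor_col b.+1 j.+1 c) a) a last.

Lemma minor_expand V b j : (b < k)%N ->
  minor V b.+1 j.+1 = \sum_a V (k + j)%N a * lead_cof V b j a.
Proof.
move=> bk; rewrite /minor (expand_det_col _ last); apply: eq_bigr => a _.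
rewrite mxE; congr (V _ _ * _); rewrite /minor_col lastE.
by rewrite (_ : _ <= _)%N ?mul1n; lia.
Qed.

Lemma lead_cofE V b j a : (b < k)%N -> lead_cof V b j a =
  (-1) ^+ (a + last) * \det (\matrix_(r < k.-1, c < k.-1)
     V (c + (k - b.+1 <= c) * j.+1)%N (lift a r)).
Proof.
move=> bk; congr (_ * \det _); apply/matrixP => r c; rewrite !mxE /minor_col.
have -> // : lift last c = c :> nat.
by rewrite /= /bump lastE leqNgt ltn_ord.
Qed.

Lemma eq_lead_cof V V' b j a : (b < k)%N ->
  (forall i, (i < k + j)%N -> V i =1 V' i) -> lead_cof V b j a = lead_cof V' b j a.
Proof.
move=> bk VV; rewrite !lead_cofE //; congr (_ * \det _); apply/matrixP => r c.
by rewrite !mxE VV //; have := ltn_ord c; case: (k - b.+1 <= c)%N => /=; lia.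
Qed.

(** Row a is deleted while column a is the basis vector e_a, so a zero column is left. *)
Lemma lead_cof_eq0 V b j (a : 'I_k) : standard V -> (b < k)%N ->
  (a < k - b.+1)%N -> lead_cof V b j a = 0.
Proof.
move=> sV bk ab; rewrite lead_cofE //.
have ak : (a < k.-1)%N by lia.
rewrite (expand_det_col _ (Ordinal ak)) big1 ?mulr0 // => r _.
rewrite mxE /= leqNgt ab addn0 sV //.
by rewrite -[nat_of_ord a == _]/(a == lift a r) (negPf (neq_lift a r)) mul0r.
Qed.

(** Deleting row a and the last column from the matrix of (b + 1, j + 1) leaves the same matrix as
    deleting row a and column a from that of (b, j), whose column a is e_a. This is the diagonal of
    the triangular system. *)
Lemma lead_cof_diag V b j (a : 'I_k) : standard V -> (b < k)%N ->
  a = (k - b.+1)%N :> nat -> exists s, lead_cof V b j a = (-1) ^+ s * minor V b j.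
Proof.
move=> sV bk aE; exists (a + last + (a + a))%N.
rewrite lead_cofE // [in RHS]exprD -[RHS]mulrA; congr (_ * _).
rewrite /minor (expand_det_col _ a) (bigD1 a) //= [X in _ = _ * (_ + X)]big1.
  rewrite mxE /minor_col (_ : (k - b <= a)%N = false) ?addn0 ?sV //; last by lia.
  rewrite eqxx mul1r addr0 /cofactor mulrA -expr2 sqrr_sign mul1r.
  congr (\det _); apply/matrixP => r c; rewrite !mxE; congr (V _ _).
  rewrite /minor_col /= /bump aE.
  by case: (leqP (k - b.+1) c) => h; [rewrite (_ : (k - b <= _)%N); lia|
    rewrite (_ : (k - b <= _)%N = false); lia].
move=> r ra; rewrite mxE /minor_col (_ : (k - b <= a)%N = false) ?addn0 ?sV //; last by lia.
by rewrite -[nat_of_ord a == _]/(a == r) eq_sym (negPf ra) mul0r.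
Qed.

End Minors.

Section Ratios.
Variables (L : fieldType).
Implicit Types (p c : nat -> nat -> L).

(** For the solution p of [Xratio p = c] this is p(b+1, j+1) p(b, j) / (p(b, j+1) p(b+1, j));
    [Xratio] is the quotient of two consecutive such expressions on a diagonal. *)
Fixpoint diag_prod c (b j : nat) : L :=
  match b, j with
  | b.+1, j.+1 => c b j * diag_prod c b j
  | _, _ => 1
  end.

(* The solution of [Xratio p = c] with value [1] when an index is at most [1]. *)
Definition minors_of_ratios c b j : L := \prod_(i < b) \prod_(l < j) diag_prod c i l.

Lemma minors_of_ratios_border c b j : (b <= 1)%N || (j <= 1)%N ->
  minors_of_ratios c b j = 1.
Proof.
move=> bj; apply: big1 => i _; apply: big1 => l _.
have : (i : nat) = 0%N \/ (l : nat) = 0%N.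
  by have := ltn_ord i; have := ltn_ord l; lia.
by case=> ->; [| case: (nat_of_ord i)].
Qed.

Variables (c : nat -> nat -> L).
Hypothesis c0 : forall b j, c b j != 0.

Lemma diag_prod_neq0 b j : diag_prod c b j != 0.
Proof.
elim: b j => [|b IH] [|j] /=; rewrite ?oner_neq0 //.
by rewrite mulf_neq0.
Qed.

Lemma minors_of_ratios_neq0 b j : minors_of_ratios c b j != 0.
Proof. by do 2!(apply/prodf_neq0 => ? _); apply: diag_prod_neq0. Qed.

Lemma minors_of_ratios_square b j :
  minors_of_ratios c b.+1 j.+1 * minors_of_ratios c b j =
  diag_prod c b j * minors_of_ratios c b j.+1 * minors_of_ratios c b.+1 j.
Proof.
rewrite /minors_of_ratios !(big_ord_recr b) /= (big_ord_recr j) /=.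
ring.
Qed.

Lemma Xratio_minors_of_ratios b j : Xratio (minors_of_ratios c) b j = c b j.
Proof.
have e1 := minors_of_ratios_square b j.
have e2 := minors_of_ratios_square b.+1 j.+1.
have n := minors_of_ratios_neq0; have r0 := diag_prod_neq0 b j.
apply: (mulIf r0); rewrite -[RHS]/(diag_prod c b.+1 j.+1) /Xratio.
move: e1 e2; set p := minors_of_ratios c in n *; set r := diag_prod _ b j in r0 *.
set s := diag_prod _ _ _ => e1 e2.
rewrite mulrAC; apply: (canLR (mulfK _)); first by rewrite !mulf_neq0.
apply: (mulIf (n b.+1 j.+1)); rewrite -/p.
transitivity (p b.+2 j.+2 * p b.+1 j.+1 * (r * p b j.+1 * p b.+1 j)); first by ring.
by rewrite -e1 e2; ring.
Qed.

End Ratios.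

(** [Xratio p b j] is solved for [p b.+2 j.+2]; the other five factors have a smaller sum of
    indices. *)
Lemma Xratio_in_subfield (L : fieldType) (P : {pred L}) (hP : divring_closed P)
    (k m : nat) (p : nat -> nat -> L) :
  (forall b j, (b <= k)%N -> (j <= m)%N -> p b j != 0) ->
  (forall b j, (b <= k)%N -> (j <= m)%N -> (b <= 1)%N || (j <= 1)%N -> p b j = 1) ->
  (forall b j, (b.+2 <= k)%N -> (j.+2 <= m)%N -> Xratio p b j \in P) ->
  forall b j, (b <= k)%N -> (j <= m)%N -> p b j \in P.
Proof.
move=> p0 p1 XP b j; have [s] := ubnP (b + j)%N; elim: s b j => // s IH b j bjs bk jm.
suff : p b j \in subfield_pred hP by [].
have [b1|b1] := leqP b 1; first by rewrite p1 ?b1 ?rpred1.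
have [j1|j1] := leqP j 1; first by rewrite p1 ?j1 ?orbT ?rpred1.
case: b j b1 j1 bjs bk jm => [|[|b]] // [|[|j]] // _ _ bjs bk jm.
have -> : p b.+2 j.+2 = Xratio p b j * (p b.+1 j.+2 * p b.+2 j.+1 * p b j) /
    (p b.+1 j * p b j.+1).
  rewrite /Xratio divfK; last by rewrite !mulf_neq0 ?p0 //; lia.
  by rewrite mulrAC divff ?mul1r // mulf_neq0 ?p0 //; lia.
have IH' b' j' : (b' <= b.+2)%N -> (j' <= j.+2)%N -> (b' + j' < b.+2 + j.+2)%N ->
    p b' j' \in subfield_pred hP.
  by move=> *; apply: IH; lia.
have X' : Xratio p b j \in subfield_pred hP by apply: XP.
by apply: rpred_div; do ![apply: rpredM => //]; apply: IH'; lia.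
Qed.

Section Columns.
Variables (L : fieldType) (k : nat) (last : 'I_k).
Hypothesis lastE : last = k.-1 :> nat.
Implicit Types (V : nat -> 'I_k -> L) (p : nat -> nat -> L).

Lemma minor_standard00 V : standard V -> minor V 0 0 = 1.
Proof.
move=> sV; rewrite -[RHS](det1 L k); congr (\det _); apply/matrixP => a c.
by rewrite !mxE /minor_col muln0 addn0 sV // -[nat_of_ord c == _]/(c == a) eq_sym.
Qed.

Lemma lead_cof_diag_neq0 V b j (a : 'I_k) : standard V -> (b < k)%N ->
  a = (k - b.+1)%N :> nat -> minor V b j != 0 -> lead_cof last V b j a != 0.
Proof.
move=> sV bk aE V0; have [s ->] := lead_cof_diag lastE j sV bk aE.
by rewrite mulf_neq0 // signr_eq0.
Qed.

Lemma exists_minors p :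
  (forall j, p 0%N j = 1) -> (forall b, p b 0%N = 1) -> (forall b j, p b j != 0) ->
  forall m, exists V, standard V /\
    forall b j, (b <= k)%N -> (j <= m)%N -> minor V b j = p b j.
Proof.
move=> p0j pb0 p0; elim=> [|m [V [sV Vp]]].
  exists (fun i (a : 'I_k) => (i == a :> nat)%:R); split=> // b j _; rewrite leqn0 => /eqP ->.
  by rewrite minor_col0 minor_standard00 ?pb0.
(* Reversing the coordinates makes the system lower triangular by [lead_cof_eq0]; its diagonal
   consists of earlier minors up to sign. *)
pose T := \matrix_(b < k, a < k) lead_cof last V b m (rev_ord a).
have T0 : T \in unitmx.
  rewrite unitmxE unitfE det_trig; last first.
    apply/is_trig_mxP => b a ba; rewrite mxE lead_cof_eq0 //=.
    by have := ltn_ord a; lia.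
  apply/prodf_neq0 => b _; rewrite mxE.
  by apply: lead_cof_diag_neq0 => //; rewrite Vp // ltnW.
pose v := invmx T *m \col_(b < k) p b.+1 m.+1.
(* Only column k + m is changed, so the minors with j <= m and the coefficients of the system stay
   the same. *)
pose V' i a := if i == (k + m)%N then v (rev_ord a) 0 else V i a.
have VV' i : (i < k + m)%N -> V' i =1 V i by move=> h a; rewrite /V' ltn_eqF.
exists V'; split.
  by move=> i a ik; rewrite VV' ?sV // (leq_trans ik) ?leq_addr.
move=> b j bk; rewrite leq_eqVlt ltnS => /predU1P[->|jm]; last first.
  by rewrite -Vp //; apply: eq_minor => i ij; apply: VV'; lia.
case: b bk => [_|b bk].
  by rewrite p0j minor_row0 -(pb0 0%N) -Vp //; apply: eq_minor => i ij; apply: VV'; lia.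
rewrite (minor_expand lastE) //.
have /matrixP/(_ (Ordinal bk) 0) : T *m v = \col_(b < k) p b.+1 m.+1.
  by rewrite mulmxA mulmxV // mul1mx.
rewrite !mxE /= => <-; rewrite (reindex_inj rev_ord_inj); apply: eq_bigr => a _.
by rewrite (eq_lead_cof lastE _ bk VV') [T _ _]mxE /V' eqxx rev_ordK mulrC.
Qed.

Lemma entries_in_subfield (P : {pred L}) (hP : divring_closed P) V m :
  standard V ->
  (forall b j, (b <= k)%N -> (j <= m)%N -> minor V b j != 0) ->
  (forall b j, (b <= k)%N -> (j <= m)%N -> minor V b j \in P) ->
  forall i a, (i < k + m)%N -> V i a \in P.
Proof.
move=> sV V0 VP; suff H : forall j, (j <= m)%N -> forall i a, (i < k + j)%N ->
  V i a \in subfield_pred hP by move=> i a; apply: H.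
elim=> [_ i a|j IH jm i a].
  by rewrite addn0 => ik; rewrite sV //; case: eqP => _; rewrite ?rpred1 ?rpred0.
rewrite addnS ltnS leq_eqVlt => /predU1P[->|]; last by apply: IH; apply: ltnW.
have lP b a' : (b < k)%N -> lead_cof last V b j a' \in subfield_pred hP.
  move=> bk; rewrite lead_cofE // rpredM ?rpredX ?rpredN ?rpred1 //.
  rewrite rpred_sum // => s _; rewrite rpredM ?rpredX ?rpredN ?rpred1 //.
  apply: rpred_prod => r _; rewrite mxE IH ?(ltnW jm) //.
  have := ltn_ord (s r); case: (k - b.+1 <= s r)%N => /=; lia.
(* The column is recovered from the bottom up: the equation of the minor (b + 1, j + 1) involves
   only the entry k - b - 1 and those below it. *)
suff H b : (b < k)%N -> forall a' : 'I_k, (a' + b.+1 = k)%N ->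
    V (k + j)%N a' \in subfield_pred hP.
  by apply: (H (k - a.+1)%N); have := ltn_ord a; lia.
elim/ltn_ind: b => b IHb bk a' ab.
have mP : minor V b.+1 j.+1 \in subfield_pred hP by apply: VP.
have l0 : lead_cof last V b j a' != 0.
  by apply: lead_cof_diag_neq0 => //; [lia | rewrite V0 // ltnW].
have E : minor V b.+1 j.+1 = \sum_a V (k + j)%N a * lead_cof last V b j a.
  exact: minor_expand.
have -> : V (k + j)%N a' = (minor V b.+1 j.+1 -
    \sum_(a | a != a') V (k + j)%N a * lead_cof last V b j a) / lead_cof last V b j a'.
  by rewrite E (bigD1 a') //= addrK mulfK.
rewrite rpred_div ?lP // rpredB //; apply: rpred_sum => d da.
have [h|h] := ltnP d a'.
  by rewrite (lead_cof_eq0 lastE) ?mulr0 ?rpred0 //; lia.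
have {}h : (a' < d)%N by rewrite ltn_neqAle h andbT eq_sym.
rewrite rpredM ?lP //; apply: (IHb (k - d.+1)%N); have := ltn_ord d; lia.
Qed.

End Columns.

Section Normalisation.
Variables (L : fieldType) (k m : nat) (V : nat -> 'I_k -> L).
Hypotheses (k2 : (2 <= k)%N) (m1 : (1 <= m)%N).
Hypothesis V0 : forall b j, (b <= k)%N -> (j <= m)%N -> minor V b j != 0.

(* The torus element for which all minors of the rescaled vectors with [b <= 1] or
   [j <= 1] equal [P_*]. *)
Definition normal_scale (i : nat) : L :=
  if (i < k)%N then minor V (k - i) 1 / minor V 0 0
  else if (i < k + m)%N then minor V 1 1 / minor V 1 (i - k).+1
  else 1.

Lemma normal_scale_neq0 i : normal_scale i != 0.
Proof.
rewrite /normal_scale; case: ifP => ik.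
  by rewrite mulf_neq0 ?invr_eq0 ?V0 ?leq_subr.
case: ifP => im; last exact: oner_neq0.
by rewrite mulf_neq0 ?invr_eq0 ?V0 //; lia.
Qed.

Local Notation U := (fun i a => V i a * normal_scale i).

Lemma minor_normal_scale b j : minor U b j =
  minor V b j * \prod_(c < k) normal_scale (minor_col k b j c).
Proof. exact: minor_scale. Qed.

Lemma minor_normal_scale_neq0 b j : (b <= k)%N -> (j <= m)%N -> minor U b j != 0.
Proof.
move=> bk jm; rewrite minor_normal_scale mulf_neq0 ?V0 //.
by apply/prodf_neq0 => c _; apply: normal_scale_neq0.
Qed.

Lemma minor_normal_scale_border b j : (b <= k)%N -> (j <= m)%N ->
  (b <= 1)%N || (j <= 1)%N -> minor U b j = minor U 0 0.
Proof.
move=> bk jm.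
have t0 := normal_scale_neq0; set t := normal_scale in t0 *.
have h0 r : \prod_(i < r) t i != 0 by apply/prodf_neq0.
have v00 : minor V 0 0 != 0 by apply: V0.
have v11 : minor V 1 1 != 0 by apply: V0 => //; lia.
have W00 : \prod_(c < k) t (minor_col k 0 0 c) = \prod_(i < k) t i.
  by apply: eq_bigr => c _; rewrite /minor_col muln0 addn0.
case: b bk => [|b] bk; first by rewrite minor_row0.
case: j jm => [|j] jm; first by rewrite minor_col0.
have := prod_minor_col t j.+1 bk; rewrite !minor_scale W00.
set W := \prod_(c < k) _ => WE.
have vbj : minor V b.+1 j.+1 != 0 by apply: V0.
case/orP; rewrite ltnS leqn0 => /eqP z; subst.
(* First row: column k + j replaces column k - 1, and the scale of the former divided by that of the
   latter is [minor V 0 0 / minor V 1 j.+1]. *)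
- move: WE; have -> : (k + j.+1 - 1 = k + j)%N by lia.
  rewrite addnS [in RHS]big_ord_recr /= => WE.
  have -> : W = \prod_(i < k - 1) t i * t (k + j)%N.
    by apply: (mulIf (h0 (k + j)%N)); rewrite WE; ring.
  have kE : k = (k - 1).+1 by lia.
  rewrite [in RHS](_ : \prod_(i < k) t i = \prod_(i < k - 1) t i * t (k - 1)%N);
    last by rewrite -!(big_mkord xpredT t) [in LHS]kE big_nat_recr.
  rewrite mulrCA [RHS]mulrCA; congr (_ * _).
  rewrite /t /normal_scale ltnNge leq_addr /= ltn_add2l jm.
  rewrite (_ : (k - 1 < k)%N); last by lia.
  rewrite (_ : (k - (k - 1) = 1)%N); last by lia.
  rewrite (_ : (k + j - k = j)%N); last by lia.
  by rewrite mulrCA mulfV // mulrCA mulfV.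
(* First column: column k, of scale 1, replaces column k - b - 1, of scale
   [minor V b.+1 1 / minor V 0 0]. *)
- have tk : t k = 1.
    by rewrite /t /normal_scale ltnn -{1}(addn0 k) ltn_add2l m1 subnn divff.
  move: WE; rewrite addn1 big_ord_recr /= tk mulr1.
  have -> : (k.+1 - b.+1 = (k - b.+1).+1)%N by lia.
  rewrite [in LHS]big_ord_recr /= => WE.
  have <- : W * t (k - b.+1)%N = \prod_(i < k) t i.
    by apply: (mulfI (h0 (k - b.+1)%N)); rewrite -WE; ring.
  rewrite [LHS]mulrC [RHS]mulrCA; congr (_ * _).
  rewrite /t /normal_scale (_ : (k - b.+1 < k)%N); last by lia.
  by rewrite subKn // mulrCA divff ?mulr1.
Qed.

Definition normal_frame : 'M[L]_k := \matrix_(a, c) U c a.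
Definition normal_mx : 'M[L]_k := invmx normal_frame.
Definition normal_form (i : nat) (a : 'I_k) : L := \sum_d normal_mx a d * U i d.

Lemma det_normal_frame : \det normal_frame = minor U 0 0.
Proof.
congr (\det _); apply/matrixP => a c.
by rewrite !mxE /minor_col muln0 addn0.
Qed.

Lemma normal_frame_unit : normal_frame \in unitmx.
Proof. by rewrite unitmxE unitfE det_normal_frame minor_normal_scale_neq0. Qed.

Lemma normal_mx_unit : normal_mx \in unitmx.
Proof. by rewrite unitmx_inv normal_frame_unit. Qed.

Lemma normal_form_standard : standard normal_form.
Proof.
move=> i a ik; have /matrixP/(_ a (Ordinal ik)) := mulVmx normal_frame_unit.
rewrite !mxE => e; rewrite -[RHS]/((Ordinal ik == a)%:R) eq_sym -e.
by apply: eq_bigr => d _; rewrite !mxE.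
Qed.

Lemma minor_normal_form b j : minor normal_form b j = minor U b j / minor U 0 0.
Proof. by rewrite minor_mull det_inv det_normal_frame mulrC. Qed.

Lemma normal_form_neq0 b j : (b <= k)%N -> (j <= m)%N -> minor normal_form b j != 0.
Proof.
by move=> *; rewrite minor_normal_form mulf_neq0 ?invr_eq0 ?minor_normal_scale_neq0.
Qed.

Lemma normal_form_border b j : (b <= k)%N -> (j <= m)%N ->
  (b <= 1)%N || (j <= 1)%N -> minor normal_form b j = 1.
Proof.
move=> *; rewrite minor_normal_form minor_normal_scale_border // divff //.
exact: minor_normal_scale_neq0.
Qed.

(** The change of frame divides every minor by one scalar, and [Xratio] is homogeneous of degree
    0. *)
Lemma Xratio_normal_form b j : (b.+2 <= k)%N ->
  Xratio (minor normal_form) b j = Xratio (minor V) b j.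
Proof.
move=> bk; rewrite -(Xratio_scale (minor V) j bk normal_scale_neq0).
rewrite /Xratio !minor_normal_form !minor_normal_scale.
have := minor_normal_scale_neq0 (leq0n k) (leq0n m).
rewrite minor_normal_scale; set D := _ * _ => D0.
set x1 := _ * \prod_(c < k) _; set x2 := _ * \prod_(c < k) _; set x3 := _ * \prod_(c < k) _.
set y1 := minor V b.+1 j.+2 * _; set y2 := minor V b.+2 j.+1 * _; set y3 := minor V b j * _.
transitivity ((x1 * x2 * x3) * D^-1 ^+ 3 / ((y1 * y2 * y3) * D^-1 ^+ 3)).
  by congr (_ / _); ring.
by rewrite -mulf_div divff ?mulr1 // expf_neq0 // invr_eq0.
Qed.

Lemma normal_form_in_subfield (P : {pred L}) (hP : divring_closed P) :
  (forall b j, (b.+2 <= k)%N -> (j.+2 <= m)%N -> Xratio (minor V) b j \in P) ->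
  forall i a, (i < k + m)%N -> normal_form i a \in P.
Proof.
move=> XP; have lk : (k.-1 < k)%N by lia.
apply: (@entries_in_subfield L k (Ordinal lk) erefl P hP).
- exact: normal_form_standard.
- exact: normal_form_neq0.
- apply: (Xratio_in_subfield hP) => [b j|b j|b j bk jm].
  + exact: normal_form_neq0.
  + exact: normal_form_border.
  + by rewrite Xratio_normal_form // XP.
Qed.

End Normalisation.

(** * Polynomial functions and dense sets of points *)

Section SeparatelyPolynomial.
Variables (K : fieldType) (I : eqType).
Implicit Types (f g : (I -> K) -> K) (x : I -> K).

(** Polynomiality in one variable at a time suffices for the density argument and is checked
    directly on functions built from determinants and polynomial evaluations. *)
Definition separately_poly f : Prop :=
  forall i x, exists u : {poly K}, forall z, f [eta x with i |-> z] = u.[z].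

Lemma sep_cst c : separately_poly (fun=> c).
Proof. by move=> i x; exists c%:P => z; rewrite hornerC. Qed.

Lemma sep_coord i : separately_poly (fun x => x i).
Proof.
move=> j x; case: (eqVneq i j) => [->|ij].
  by exists 'X => z; rewrite /= eqxx hornerX.
by exists (x i)%:P => z; rewrite /= (negPf ij) hornerC.
Qed.

Lemma sepD f g : separately_poly f -> separately_poly g ->
  separately_poly (fun x => f x + g x).
Proof.
move=> hf hg i x; have [u fu] := hf i x; have [v gv] := hg i x.
by exists (u + v) => z; rewrite hornerD fu gv.
Qed.

Lemma sepM f g : separately_poly f -> separately_poly g ->
  separately_poly (fun x => f x * g x).
Proof.
move=> hf hg i x; have [u fu] := hf i x; have [v gv] := hg i x.
by exists (u * v) => z; rewrite hornerM fu gv.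
Qed.

Lemma sepX f n : separately_poly f -> separately_poly (fun x => f x ^+ n).
Proof.
move=> hf i x; have [u fu] := hf i x.
by exists (u ^+ n) => z; rewrite horner_exp fu.
Qed.

Lemma sep_sum (J : Type) (r : seq J) (F : J -> (I -> K) -> K) :
  (forall j, separately_poly (F j)) -> separately_poly (fun x => \sum_(j <- r) F j x).
Proof.
move=> hF i x; have [u Fu] := choice (fun j => hF j i x).
by exists (\sum_(j <- r) u j) => z; rewrite horner_sum; apply: eq_bigr.
Qed.

Lemma sep_prod (J : Type) (r : seq J) (F : J -> (I -> K) -> K) :
  (forall j, separately_poly (F j)) -> separately_poly (fun x => \prod_(j <- r) F j x).
Proof.
move=> hF i x; have [u Fu] := choice (fun j => hF j i x).
by exists (\prod_(j <- r) u j) => z; rewrite horner_prod; apply: eq_bigr.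
Qed.

Lemma sep_det n (M : (I -> K) -> 'M[K]_n) :
  (forall a b, separately_poly (fun x => M x a b)) -> separately_poly (fun x => \det (M x)).
Proof.
move=> hM; apply: sep_sum => s; apply: sepM; first exact: sep_cst.
by apply: sep_prod.
Qed.

Lemma sep_mmap (C : comNzRingType) n (h : C -> K) (y : (I -> K) -> 'I_n -> K)
    (p : {mpoly C[n]}) :
  (forall i, separately_poly (fun x => y x i)) ->
  separately_poly (fun x => mmap h (y x) p).
Proof.
move=> hy; apply: sep_sum => m; apply: sepM; first exact: sep_cst.
by apply: sep_prod => i; apply: sepX.
Qed.

End SeparatelyPolynomial.

(** The coordinates are freed one at a time from the values of [s]: with the others fixed, [f] is a
    polynomial in one variable with infinitely many roots. *)
Lemma separately_poly_eq0 (K : fieldType) (I : finType) (f : (I -> K) -> K)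
    (s : nat -> K) : injective s -> separately_poly f ->
  (forall r : I -> nat, f (s \o r) = 0) -> forall x, f x = 0.
Proof.
move=> s_inj sf f0.
suff H (l : seq I) : forall x, (forall i, i \notin l -> exists r, x i = s r) -> f x = 0.
  by move=> x; apply: (H (enum I)) => i; rewrite mem_enum.
elim: l => [|i l IH] x xl.
  have [r xr] := choice (fun i => xl i isT).
  by rewrite (_ : x = s \o r) //; apply: funext.
have [u fu] := sf i x.
have u0 : u = 0.
  apply/eqP/negPn/negP => /(max_poly_roots (rs := [seq s r | r <- iota 0 (size u)])).
  rewrite map_inj_uniq // iota_uniq size_map size_iota ltnn => H.
  suff : false by []; apply: H => //.
  apply/allP => _ /mapP[r _ ->]; rewrite /root -fu IH // => j jl /=.
  case: (eqVneq j i) => [_|ji]; first by exists r.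
  by apply: xl; rewrite inE negb_or ji.
have -> : x = [eta x with i |-> x i] by apply: funext => j /=; case: eqP => [->|].
by rewrite fu u0 horner0.
Qed.

(** * The initial seed *)

Section FracExtMorphism.
Variables (D : idomainType) (F : fieldType) (phi : {rmorphism D -> F}).
Hypothesis phi_inj : injective phi.

(** The proof of injectivity is an argument because the morphism laws below depend on it. *)
Definition frac_ext_morph of injective phi : {fraction D} -> F := frac_ext phi.

Let ext := frac_ext_morph phi_inj.

Lemma frac_ext_morph_zmod : zmod_morphism ext.
Proof. by move=> f g; rewrite /ext /frac_ext_morph frac_extB. Qed.

Lemma frac_ext_morph_monoid : monoid_morphism ext.
Proof.
split=> [|f g]; rewrite /ext /frac_ext_morph ?frac_ext1 //.
by rewrite -{1}[g]invrK frac_ext_div // -[g^-1]mul1r frac_ext_div // frac_ext1 // mul1r invrK.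
Qed.

HB.instance Definition _ :=
  GRing.isZmodMorphism.Build {fraction D} F ext frac_ext_morph_zmod.
HB.instance Definition _ :=
  GRing.isMonoidMorphism.Build {fraction D} F ext frac_ext_morph_monoid.

Definition frac_ext_rmorph : {rmorphism {fraction D} -> F} := ext.

End FracExtMorphism.

Section Quiver.
Variables (k n : nat) (L : fieldType).

(** The vertex [*] gets the indices (0, 0), and (b, e) the indices (b, e - k), as for [minor]. *)
Definition vrow (v : vertex k n) : nat := if v is Some w then w.1.+1 else 0%N.
Definition vcol (v : vertex k n) : nat := if v is Some w then w.2.+1 else 0%N.

Lemma vrow_le v : (vrow v <= k)%N.
Proof. by case: v => [[b e]|] //=. Qed.

Lemma vcol_le v : (vcol v <= n - k)%N.
Proof. by case: v => [[b e]|] //=. Qed.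

Lemma prod_pair_delta (a b x y : nat) (F : nat -> nat -> L) :
  \prod_(w : 'I_a * 'I_b) F w.1 w.2 ^+ ((w.1 == x :> nat) && (w.2 == y :> nat)) =
  if (x < a)%N && (y < b)%N then F x y else 1.
Proof.
case: ifP => [/andP[xa yb]|h].
  rewrite (bigD1 (Ordinal xa, Ordinal yb)) //= !eqxx expr1 big1 ?mulr1 // => -[i j].
  by rewrite xpair_eqE -!val_eqE /= => /negPf ->.
apply: big1 => -[i j] _ /=; case: eqP => //= ix; case: eqP => //= jy.
by move: h; rewrite -ix -jy !ltn_ord.
Qed.

Lemma prod_pair_deltaS (a b x y : nat) (F : nat -> nat -> L) :
  \prod_(w : 'I_a * 'I_b) F w.1 w.2 ^+ ((w.1.+1 == x) && (w.2.+1 == y)) =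
  if [&& 0 < x <= a & 0 < y <= b]%N then F x.-1 y.-1 else 1.
Proof.
case: x => [|x]; first by rewrite big1 // => w _.
case: y => [|y]; first by rewrite ltnn andbF big1 // => w _; rewrite andbF.
by rewrite -(prod_pair_delta a b x y).
Qed.

Lemma prod_vertex (A : vertex k n -> L) :
  \prod_v A v = A None * \prod_w A (Some w).
Proof.
rewrite (bigD1 None) //=; congr (_ * _).
rewrite (reindex_omap Some id) /=; last by case.
by apply: eq_bigl => w; rewrite eqxx.
Qed.

Variables (p : nat -> nat -> L).
Hypotheses (p0j : forall j, p 0 j = p 0%N 0%N) (pb0 : forall b, p b 0%N = p 0%N 0%N).
Hypothesis p_neq0 : forall b j, (b <= k)%N -> (j <= n - k)%N -> p b j != 0.

Local Notation A := (fun v : vertex k n => p (vrow v) (vcol v)).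

Lemma unfrozenP (v : vertex k n) : v \notin frozen k n ->
  exists w : 'I_k * 'I_(n - k), [/\ v = Some w, (w.1.+1 < k)%N & (w.2.+1 < n - k)%N].
Proof.
case: v => [[b e]|]; rewrite inE //= negb_or /row_of /col_of /= => /andP[bk en].
exists (b, e); split=> //=; first by rewrite ltn_neqAle bk ltn_ord.
by have := ltn_ord e; lia.
Qed.

(** The factors of [Xratio] belong to the neighbours in the quiver. On the border, a factor without
    a neighbour equals [p 0 0]; such factors cancel in pairs, except that one survives at (1, k +
    1), where it matches the arrow from [*]. *)
Lemma xmono_Xratio (w : 'I_k * 'I_(n - k)) :
  (w.1.+1 < k)%N -> (w.2.+1 < n - k)%N ->
  \prod_v A v ^ init_exch (Some w) v = Xratio p w.1 w.2.
Proof.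
case: w => b e /= bk en.
have A0 v : A v != 0 by apply: p_neq0; [exact: vrow_le | exact: vcol_le].
pose q b' e' := p b'.+1 e'.+1.
(* The indices x and y count from 1, so a delta at index 0 vanishes and stands for an absent
   neighbour. *)
pose dl (w : 'I_k * 'I_(n - k)) x y : nat := (w.1.+1 == x) && (w.2.+1 == y).
have into w : arrow (Some w) (Some (b, e)) = (dl w b.+1 e + dl w b e.+1 + dl w b.+2 e.+2)%N :> nat.
  case: w => b' e'; rewrite /dl /= /row_of /col_of /=.
  have := ltn_ord b'; have := ltn_ord e'; clear -bk.
  move: (nat_of_ord b) (nat_of_ord e) (nat_of_ord b') (nat_of_ord e') bk => i j i' j'.
  do ![case: eqP => /= ?]; lia.
have outof w : arrow (Some (b, e)) (Some w) = (dl w b.+1 e.+2 + dl w b.+2 e.+1 + dl w b e)%N :> nat.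
  case: w => b' e'; rewrite /dl /= /row_of /col_of /=.
  have := ltn_ord b'; have := ltn_ord e'; clear -bk.
  move: (nat_of_ord b) (nat_of_ord e) (nat_of_ord b') (nat_of_ord e') bk => i j i' j'.
  do ![case: eqP => /= ?]; lia.
transitivity ((\prod_v A v ^+ arrow v (Some (b, e))) / (\prod_v A v ^+ arrow (Some (b, e)) v)).
  rewrite -prodfV -big_split; apply: eq_bigr => v _ /=.
  by rewrite /init_exch expfzDr // -invr_expz.
rewrite !prod_vertex /=.
under eq_bigr => w _ do rewrite into !exprD -[p _ _]/(q w.1 w.2).
under [X in _ / (_ * X)]eq_bigr => w _ do rewrite outof !exprD -[p _ _]/(q w.1 w.2).
rewrite !big_split /= /dl !prod_pair_deltaS.
have B0 i j : (i <= b.+2)%N -> (j <= e.+2)%N -> p i j != 0.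
  by move=> ib je; apply: p_neq0; [exact: leq_trans bk | exact: leq_trans en].
have -> : (row_of (b, e) == 1%N) && (col_of (b, e) == k.+1) =
    (b == 0%N :> nat) && (e == 0%N :> nat).
  by rewrite /row_of /col_of /=; do ![case: eqP => /= ?]; lia.
rewrite /Xratio /q; clear into outof A0; move: bk en B0.
move: (nat_of_ord b) (nat_of_ord e) => i j ik jn B0.
rewrite ik jn (ltnW ik) (ltnW jn) /= !andbT.
have [ik0 jn0] : (i <= k)%N /\ (j <= n - k)%N by lia.
have n1 : p 0 0 != 0 by apply: B0.
have n2 : p i j != 0 by apply: B0; lia.
have n3 : p i.+1 j.+2 != 0 by apply: B0; lia.
have n4 : p i.+2 j.+1 != 0 by apply: B0; lia.
rewrite ik0 jn0; clear B0 ik0 jn0 ik jn.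
by case: i n2 n3 n4 => [|i] n2 n3 n4; case: j n2 n3 n4 => [|j] n2 n3 n4;
  rewrite ?p0j ?pb0 /= in n2 *; field; rewrite ?n1 ?n2 ?n3 ?n4.
Qed.
End Quiver.

Section Evaluation.
Variables (C : fieldType) (k n : nat).

Definition cols (L : fieldType) (M : 'M[L]_(k, n)) (i : nat) (a : 'I_k) : L :=
  oapp (M a) 0 (insub i).

Section At.
Variables (L : fieldType) (h : {rmorphism C -> L}).

Definition pev (M : 'M[L]_(k, n)) : {rmorphism {mpoly C[k * n]} -> L} :=
  mmap h (fun i => mxvec M 0 i).

Lemma pevC M c : pev M c%:MP = h c.
Proof. exact: mmapC. Qed.

Lemma pev_genmx M : map_mx (pev M) (Defs.genmx C k n) = M.
Proof.
by apply/matrixP => a i; rewrite !mxE /pev /= mmapX mmap1U mxvecE.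
Qed.

Lemma pev_subst M N p : pev M (subst N p) = pev (map_mx (pev M) N) p.
Proof.
rewrite /subst /comp_mpoly rmorph_mmap; apply: eq_mmap => [c|i].
  by rewrite /= pevC.
by rewrite /= tnth_mktuple; case/mxvec_indexP: i => a i; rewrite !mxvecE mxE.
Qed.

Lemma pev_SLmx M g : map_mx (pev M) (SLmx n g) = map_mx h g *m M.
Proof.
rewrite map_mxM pev_genmx; congr (_ *m _).
by apply/matrixP => a b; rewrite !mxE pevC.
Qed.

Lemma pev_Tmx M t : map_mx (pev M) (Tmx k t) = M *m diag_mx (map_mx h t).
Proof.
rewrite map_mxM pev_genmx map_diag_mx; congr (_ *m diag_mx _).
by apply/matrixP => a b; rewrite !mxE pevC.
Qed.

(** Invariance of p / q is kept in cross-multiplied form, so that it can be evaluated at every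
    matrix, even where [q] vanishes. *)
Lemma pev_cross_SL M g p q :
  subst (SLmx n g) p * q = p * subst (SLmx n g) q ->
  pev (map_mx h g *m M) p * pev M q = pev M p * pev (map_mx h g *m M) q.
Proof. by move/(congr1 (pev M)); rewrite !rmorphM /= !pev_subst pev_SLmx. Qed.

Lemma pev_cross_T M t p q :
  subst (Tmx k t) p * q = p * subst (Tmx k t) q ->
  pev (M *m diag_mx (map_mx h t)) p * pev M q =
  pev M p * pev (M *m diag_mx (map_mx h t)) q.
Proof. by move/(congr1 (pev M)); rewrite !rmorphM /= !pev_subst pev_Tmx. Qed.

Lemma pev_plucker M (v : vertex k n) :
  pev M (plucker_poly C k n (init_label v)) = minor (cols M) (vrow v) (vcol v).
Proof.
rewrite /plucker_poly -det_map_mx; congr (\det _); apply/matrixP => a c.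
rewrite !mxE /cols /Defs.coord (_ : (nth 0%N _ c).-1 = minor_col k (vrow v) (vcol v) c).
  case: insubP => [i _ _|_] /=; last exact: rmorph0.
  by have /matrixP/(_ a i) := pev_genmx M; rewrite mxE.
have ck := ltn_ord c; rewrite /minor_col; case: v => [[b e]|] /=; last first.
  by rewrite muln0 addn0 nth_iota.
rewrite nth_cat size_iota /row_of /col_of /=.
have := ltn_ord b; case: (ltnP c (k - b.+1)) => kc bk.
  by rewrite nth_iota //= addn0.
rewrite -[X in nth _ X]/(iota ((e + k).+1 - b.+1).+1 b.+1) nth_iota; lia.
Qed.

End At.

Local Notation K := (ratVn C k n).

Definition iotaK : {rmorphism C -> K} := tofrac \o @mpolyC (k * n) C.

Definition generic_mx : 'M[K]_(k, n) := map_mx tofrac (Defs.genmx C k n).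

Lemma pev_G p : pev iotaK generic_mx p = tofrac p.
Proof.
rewrite [in RHS](mpolyE p) rmorph_sum; apply: eq_bigr => m _.
rewrite -mul_mpolyC rmorphM; congr (_ * _).
rewrite [in RHS]mpolyXE_id rmorph_prod; apply: eq_bigr => i _.
by rewrite rmorphXn /=; case/mxvec_indexP: i => a i; rewrite mxvecE !mxE.
Qed.

Lemma minor_G (v : vertex k n) :
  minor (cols generic_mx) (vrow v) (vcol v) = tofrac (plucker_poly C k n (init_label v)).
Proof. by rewrite -(pev_plucker iotaK) pev_G. Qed.

Lemma vertex_of b j : (b <= k)%N -> (j <= n - k)%N ->
  exists v : vertex k n, forall (L : fieldType) (V : nat -> 'I_k -> L),
    minor V b j = minor V (vrow v) (vcol v).
Proof.
case: b => [|b] bk; first by exists None => L V; rewrite minor_row0.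
case: j => [|j] jn; first by exists None => L V; rewrite minor_col0.
by exists (Some (Ordinal bk, Ordinal jn)).
Qed.

Lemma exists_matrix (L : fieldType) (c : nat -> nat -> L) : (0 < k)%N -> (k <= n)%N ->
  (forall b j, c b j != 0) -> exists M : 'M[L]_(k, n),
  forall b j, (b <= k)%N -> (j <= n - k)%N -> minor (cols M) b j = minors_of_ratios c b j.
Proof.
move=> k0 kn c0; have lk : (k.-1 < k)%N by lia.
have [V [sV Vp]] := @exists_minors L k (Ordinal lk) erefl (minors_of_ratios c)
  (fun j => @minors_of_ratios_border L c 0 j isT)
  (fun b => @minors_of_ratios_border L c b 0 (orbT _)) (minors_of_ratios_neq0 c0) (n - k)%N.
exists (\matrix_(a, i) V i a) => b j bk jn; rewrite -Vp //; apply: eq_minor => i ij a.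
have ein : (i < n)%N by lia.
by rewrite /cols insubT /= mxE.
Qed.

(** The generic minor specialises to a nonzero value at a matrix built for the constant ratios 1. *)
Lemma minor_G_neq0 b j : (0 < k)%N -> (k <= n)%N ->
  (b <= k)%N -> (j <= n - k)%N -> minor (cols generic_mx) b j != 0.
Proof.
move=> k0 kn bk jn; have [v vE] := vertex_of bk jn.
have [M ME] := exists_matrix k0 kn (fun _ _ => oner_neq0 C).
rewrite vE minor_G tofrac_eq0; apply/eqP => e.
have := pev_plucker idfun M v; rewrite e rmorph0 -vE ME // => /esym/eqP.
by rewrite (negPf (minors_of_ratios_neq0 _ _ _)) // => *; apply: oner_neq0.
Qed.

End Evaluation.

Lemma rmorph_Xratio (L F : fieldType) (h : {rmorphism L -> F}) (p : nat -> nat -> L) b j :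
  h (Xratio p b j) = Xratio (fun b j => h (p b j)) b j.
Proof. by rewrite /Xratio fmorph_div !rmorphM. Qed.

Lemma eq_Xratio (L : fieldType) (p q : nat -> nat -> L) b j :
  (forall b j, p b j = q b j) -> Xratio p b j = Xratio q b j.
Proof. by move=> pq; rewrite /Xratio !pq. Qed.

Section Initial.
Variables (C : fieldType) (k n : nat).
Hypotheses (k2 : (2 <= k)%N) (kn : (k < n)%N).

Local Notation K := (ratVn C k n).
Local Notation S0 := (initial_seed k n C).
Local Notation G := (generic_mx C k n).
Local Notation minorG := (minor (cols G)).

Let k0 : (0 < k)%N := ltnW k2.

Lemma minorG_neq0 b j : (b <= k)%N -> (j <= n - k)%N -> minorG b j != 0.
Proof. by apply: minor_G_neq0; rewrite // ltnW. Qed.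

Lemma clvar_initial v : confV_val C k n (clvar S0 v) = minorG (vrow v) (vcol v).
Proof. by rewrite minor_G. Qed.

Lemma clvar_initial_neq0 v : clvar S0 v != 0.
Proof.
rewrite -(fmorph_eq0 (confV_val C k n)) clvar_initial.
by apply: minorG_neq0; [exact: vrow_le | exact: vcol_le].
Qed.

Lemma xmono_initial (w : 'I_k * 'I_(n - k)) :
  (w.1.+1 < k)%N -> (w.2.+1 < n - k)%N ->
  confV_val C k n (xmono S0 (Some w)) = Xratio minorG w.1 w.2.
Proof.
move=> bk en.
have e := @xmono_Xratio k n K minorG (minor_row0 _) (minor_col0 _) minorG_neq0 w bk en.
rewrite -e rmorph_prod; apply: eq_bigr => v _.
by rewrite fmorphXz clvar_initial.
Qed.

Lemma xmono_initial_T_invariant i : i \notin frozen k n ->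
  xmono S0 i \in @T_invariant C k n.
Proof.
move=> /unfrozenP[w [-> bk en]]; apply/asboolP => t t0.
rewrite xmono_initial //.
pose rho := frac_ext_rmorph (@Tmx_inj C k n t t0).
(* [Xratio_scale] takes nonzero scalars indexed by all naturals, hence the value 1 from n on. *)
pose s (i : nat) : K := oapp (fun j => iotaK C k n (t 0 j)) 1 (insub i).
have s0 j : s j != 0.
  rewrite /s; case: insubP => [u _ _|_] /=; last exact: oner_neq0.
  by rewrite tofrac_eq0 mpolyC_eq0.
have rhoS f : rsubst (Tmx k t) f = rho f by [].
rewrite rhoS -[in RHS](Xratio_scale minorG w.2 bk s0).
have rhoE b j : rho (minorG b j) = minorG b j * \prod_(c < k) s (minor_col k b j c).
  rewrite -minor_scale /minor -det_map_mx; congr (\det _); apply/matrixP => a c.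
  rewrite !mxE /cols /s; case: insubP => [u _ _|_] /=; last by rewrite rmorph0 mul0r.
  rewrite mxE -[LHS]/(frac_ext _ _) (frac_ext_tofrac (@Tmx_inj C k n t t0)) /=.
  rewrite -tofracM; congr tofrac.
  have /matrixP/(_ a u) := subst_genmx (Tmx k t); rewrite [LHS]mxE => ->.
  by rewrite /Tmx mul_mx_diag [LHS]mxE [X in _ * X]mxE.
by rewrite rmorph_Xratio; apply: eq_Xratio.
Qed.

Lemma exists_initial_X : exists x : unfrozen (frozen k n) -> ratConfP C k n,
  forall i, pstar C k n (x i) = xmono S0 (val i).
Proof.
exists (fun i => Subfield (hP := T_invariant_divring C k n)
  (xmono_initial_T_invariant (valP i))).
by [].
Qed.

Lemma initial_alg_indep (p : {mpoly C[#|(unfrozen (frozen k n) : finType)|]}) :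
  mmap (iotaK C k n)
    (fun i => confV_val C k n (xmono S0 (val (enum_val i : unfrozen (frozen k n))))) p = 0 ->
  p = 0.
Proof.
pose J : finType := unfrozen (frozen k n).
(* The value is the independent variable of the vertex if it is unfrozen, and the empty product 1
   otherwise, so it is nonzero for all indices. *)
pose c b e := \prod_(i : J | (vrow (val i) == b.+1) && (vcol (val i) == e.+1)) @genvar C J i.
have c0 b e : c b e != 0 by apply/prodf_neq0 => i _; apply: genvar_neq0.
have [M ME] := exists_matrix k0 (ltnW kn) c0.
pose io : {rmorphism {mpoly C[k * n]} -> K} := tofrac.
pose phi : {rmorphism {mpoly C[k * n]} -> {fraction {mpoly C[#|J|]}}} :=
  pev (genconst C J) M.
have io_inj : injective io := @tofrac_inj _.
apply: (@spec_alg_indep C K (iotaK C k n) J _ io phi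
  (fun i : J => confV_val C k n (xmono S0 (val i))) io_inj) => [a|i].
  by rewrite -(pevC (genconst C J) M a); apply: (spec_iota io phi).
have sA (v : vertex k n) : spec io phi (confV_val C k n (clvar S0 v))
    (minor (cols M) (vrow v) (vcol v)).
  rewrite clvar_initial minor_G -(pev_plucker (genconst C J) M).
  exact: (spec_iota io phi).
have MA (v : vertex k n) : minor (cols M) (vrow v) (vcol v) = minors_of_ratios c (vrow v) (vcol v).
  by apply: ME; [exact: vrow_le | exact: vcol_le].
have [w [iE bk en]] := unfrozenP (valP i).
have -> : genvar C i =
    \prod_(v : vertex k n) minor (cols M) (vrow v) (vcol v) ^ init_exch (val i) v.
  under eq_bigr => v _ do rewrite MA.
  rewrite iE xmono_Xratio //.
  - rewrite Xratio_minors_of_ratios // /c (big_pred1 i) // => j.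
    apply/idP/eqP => [/andP[/eqP b1 /eqP e1]|->]; last by rewrite iE /= !eqxx.
    apply: val_inj; rewrite iE; move: b1 e1; case: (val j) => [[b' e']|] //= [b1] [e1].
    by case: w {bk en iE} b1 e1 => b e /= /val_inj -> /val_inj ->.
  - by move=> j; rewrite !minors_of_ratios_border.
  - by move=> b; rewrite !minors_of_ratios_border // orbT.
  - by move=> *; apply: minors_of_ratios_neq0.
rewrite rmorph_prod; apply: spec_prod => // v _; rewrite fmorphXz.
by apply: spec_exprz => //; rewrite MA minors_of_ratios_neq0.
Qed.

End Initial.

(** * Invariant functions and their values at the normal form *)

Lemma cross_mul_trans (F : fieldType) (a b c d e f : F) :
  d != 0 -> a * d = c * b -> c * f = e * d -> a * f = e * b.
Proof. by move=> d0 ad cf; apply: (mulfI d0); rewrite mulrA [d * a]mulrC ad mulrAC cf; ring. Qed.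

Section ZariskiDensity.
Variables (C : numClosedFieldType) (k n : nat).
Hypotheses (k2 : (2 <= k)%N) (kn : (k < n)%N).
Variables (L : fieldType) (h : {rmorphism C -> L}) (G : 'M[L]_(k, n)).
Variables (p q : {mpoly C[k * n]}).

Local Notation ev := (pev h).

Hypothesis Gq : ev G q != 0.
Hypothesis cross_GL : forall (g : 'M[C]_k) (t : 'rV[C]_n),
  \det g != 0 -> (forall i, t 0 i != 0) ->
  ev (map_mx h g *m G *m diag_mx (map_mx h t)) p * ev G q =
  ev G p * ev (map_mx h g *m G *m diag_mx (map_mx h t)) q.

(** A matrix and a scaling vector are encoded as one family of coordinates, the form in which
    [separately_poly] treats them. *)
Definition gpt (x : ('I_k * 'I_k) + 'I_n -> L) : 'M[L]_k := \matrix_(a, b) x (inl (a, b)).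
Definition tpt (x : ('I_k * 'I_k) + 'I_n -> L) : 'rV[L]_n := \row_i x (inr i).
Definition act x (M : 'M[L]_(k, n)) := gpt x *m M *m diag_mx (tpt x).
Definition nondeg x : L := \det (gpt x) * \prod_i tpt x 0 i.

Lemma actE x M a i : act x M a i = (\sum_b x (inl (a, b)) * M b i) * x (inr i).
Proof.
rewrite /act mul_mx_diag !mxE; congr (_ * _).
by apply: eq_bigr => b _; rewrite mxE.
Qed.

Lemma sep_ev_act M r : separately_poly (fun x => ev (act x M) r).
Proof.
apply: (@sep_mmap L _ C _ h (fun x i => mxvec (act x M) 0 i) r) => i.
case/mxvec_indexP: i => a i.
have -> : (fun x => mxvec (act x M) 0 (mxvec_index a i)) =
    (fun x => (\sum_b x (inl (a, b)) * M b i) * x (inr i)).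
  by apply: funext => x; rewrite mxvecE actE.
apply: sepM; last exact: sep_coord.
by apply: sep_sum => b; apply: sepM; [exact: sep_coord | exact: sep_cst].
Qed.

Lemma sep_nondeg : separately_poly nondeg.
Proof.
apply: sepM.
  apply: (@sep_det L _ k gpt) => a b.
  rewrite (_ : (fun x => _) = (fun x => x (inl (a, b)))); first exact: sep_coord.
  by apply: funext => x; rewrite mxE.
apply: (@sep_prod L _ _ _ (fun i x => tpt x 0 i)) => i.
rewrite (_ : (fun x => _) = (fun x => x (inr i))); first exact: sep_coord.
by apply: funext => x; rewrite mxE.
Qed.

(** In characteristic zero the natural numbers are an infinite set of points coming from [C], where
    [cross_GL] applies. *)
Definition natpt (r : nat) : L := h r%:R.

Lemma natpt_inj : injective natpt.
Proof.
move=> r s e; have {}e : r%:R = s%:R :> C := fmorph_inj h e.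
by apply/eqP; rewrite -(eqr_nat C) e.
Qed.

Lemma gpt_nat (r : ('I_k * 'I_k) + 'I_n -> nat) :
  gpt (natpt \o r) = map_mx h (\matrix_(a, b) (r (inl (a, b)))%:R).
Proof. by apply/matrixP => a b; rewrite !mxE. Qed.

Lemma tpt_nat (r : ('I_k * 'I_k) + 'I_n -> nat) :
  tpt (natpt \o r) = map_mx h (\row_i (r (inr i))%:R).
Proof. by apply/rowP => i; rewrite !mxE. Qed.

Lemma nondegP x : nondeg x != 0 -> \det (gpt x) != 0 /\ forall i, tpt x 0 i != 0.
Proof.
rewrite mulf_eq0 negb_or => /andP[-> /prodf_neq0 t0]; split=> // i.
exact: t0.
Qed.

(* The identity [cross_GL] extends from [C]-points to [L]-points because the
   [C]-points are Zariski dense. *)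
Lemma cross_act x : nondeg x != 0 ->
  ev (act x G) p * ev G q = ev G p * ev (act x G) q.
Proof.
(* Multiplying by [nondeg] gives a polynomial identity that holds trivially at degenerate points. *)
move=> nx; apply/eqP; rewrite -subr_eq0; apply/eqP/(mulIf nx); rewrite mul0r.
move: x {nx}; apply: (separately_poly_eq0 natpt_inj) => [|r].
  apply: sepM sep_nondeg; apply: sepD.
    by apply: sepM; [exact: sep_ev_act | exact: sep_cst].
  rewrite (_ : (fun x => _) = (fun x => (- ev G p) * ev (act x G) q)); last first.
    by apply: funext => x; rewrite mulNr.
  by apply: sepM; [exact: sep_cst | exact: sep_ev_act].
have [->|/nondegP[gr tr]] := eqVneq (nondeg (natpt \o r)) 0; first by rewrite mulr0.
rewrite gpt_nat det_map_mx fmorph_eq0 in gr.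
rewrite /act gpt_nat tpt_nat cross_GL ?subrr ?mul0r // => i.
by have := tr i; rewrite tpt_nat mxE fmorph_eq0.
Qed.

(** The denominator [q] may vanish at [act x G]. Some translate by a natural-number point avoids
    this, since otherwise [q] would vanish on the whole orbit, which contains [G]. *)
Lemma generic_act_neq0 x : nondeg x != 0 ->
  exists r : ('I_k * 'I_k) + 'I_n -> nat,
    nondeg (natpt \o r) != 0 /\ ev (act (natpt \o r) (act x G)) q != 0.
Proof.
move=> nx; have [gx tx] := nondegP nx; set M := act x G.
apply: contrapT => H.
have z y : ev (act y M) q * nondeg y = 0.
  move: y; apply: (separately_poly_eq0 natpt_inj) => [|r].
    by apply: sepM sep_nondeg; apply: sep_ev_act.
  apply/eqP/negPn/negP; rewrite mulf_eq0 negb_or => /andP[a b].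
  by apply: H; exists r.
(* The inverse of [x], which carries [act x G] back to [G]. *)
pose y (i : ('I_k * 'I_k) + 'I_n) : L := match i with
  | inl ab => invmx (gpt x) ab.1 ab.2 | inr i => (tpt x 0 i)^-1 end.
have gy : gpt y = invmx (gpt x) by apply/matrixP => a b; rewrite mxE.
have ty : tpt y = map_mx GRing.inv (tpt x) by apply/rowP => i; rewrite [LHS]mxE [RHS]mxE.
have gu : gpt x \in unitmx by rewrite unitmxE unitfE.
have yM : act y M = G.
  rewrite /act gy ty /M /act !mulmxA mulVmx // mul1mx -mulmxA mulmx_diag.
  rewrite (_ : \row_i _ = const_mx 1) ?diag_const_mx ?mulmx1 //.
  by apply/rowP => i; have := tx i; rewrite !mxE => ti; rewrite mulfV.
have := z y; rewrite yM => /eqP; rewrite mulf_eq0 (negPf Gq) /=.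
rewrite /nondeg gy ty det_inv mulf_eq0 invr_eq0 (negPf gx) /=.
by apply/negP/prodf_neq0 => i _; rewrite mxE invr_eq0.
Qed.

(** The quotient has the same value at [G] and at a translate of its normal form by a natural-number
    point; there all entries lie in [P]. *)
Lemma invariant_in_subfield (P : {pred L}) (hP : divring_closed P) :
  (forall c, h c \in P) ->
  (forall b j, (b <= k)%N -> (j <= n - k)%N -> minor (cols G) b j != 0) ->
  (forall b j, (b.+2 <= k)%N -> (j.+2 <= n - k)%N -> Xratio (minor (cols G)) b j \in P) ->
  ev G p / ev G q \in P.
Proof.
move=> cP V0 XP; have m1 : (1 <= n - k)%N by rewrite subn_gt0.
pose V := cols G; pose m := (n - k)%N.
pose x (i : ('I_k * 'I_k) + 'I_n) : L := match i with
  | inl ab => normal_mx m V ab.1 ab.2 | inr i => normal_scale m V i end.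
have gx : gpt x = normal_mx m V by apply/matrixP => a b; rewrite mxE.
have nx : nondeg x != 0.
  rewrite mulf_neq0 //.
    by rewrite gx -unitfE -unitmxE normal_mx_unit.
  by apply/prodf_neq0 => i _; rewrite mxE normal_scale_neq0.
have xGP a i : act x G a i \in P.
  have := @normal_form_in_subfield L k m V k2 m1 V0 P hP XP i a.
  rewrite (_ : k + m = n)%N ?ltn_ord; last by rewrite /m subnKC // ltnW.
  move=> /(_ isT); rewrite (_ : act x G a i = normal_form m V i a) //.
  rewrite /act gx mul_mx_diag mxE [X in _ * X]mxE /normal_form mxE mulr_suml.
  by apply: eq_bigr => d _; rewrite mulrA /V /cols valK.
have [r [nr qr]] := generic_act_neq0 nx.
set y := natpt \o r in nr qr.
have yP i : y i \in P by apply: cP.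
(* The product of [y] and [x], so that [cross_act] covers both moves at once. *)
pose xy (i : ('I_k * 'I_k) + 'I_n) : L := match i with
  | inl ab => (gpt y *m gpt x) ab.1 ab.2 | inr i => tpt x 0 i * tpt y 0 i end.
have gxy : gpt xy = gpt y *m gpt x by apply/matrixP => a b; rewrite mxE.
have txy : tpt xy = \row_i (tpt x 0 i * tpt y 0 i) by apply/rowP => i; rewrite [LHS]mxE [RHS]mxE.
have xyE : act xy G = act y (act x G).
  rewrite /act gxy txy !mulmxA -mulmxA -[RHS]mulmxA mulmx_diag.
  by rewrite !mulmxA.
have nxy : nondeg xy != 0.
  have [g1 t1] := nondegP nx; have [g2 t2] := nondegP nr.
  rewrite /nondeg gxy txy det_mulmx !mulf_neq0 //.
  by apply/prodf_neq0 => i _; rewrite mxE mulf_neq0.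
have e := cross_act nxy; rewrite xyE in e.
have -> : ev G p / ev G q = ev (act y (act x G)) p / ev (act y (act x G)) q.
  by apply/eqP; rewrite GRing.eqr_div // -e mulrC.
have MP s : ev (act y (act x G)) s \in P.
  apply: mmap_subfield => // i; case/mxvec_indexP: i => a i; rewrite mxvecE.
  suff : act y (act x G) a i \in subfield_pred hP by [].
  rewrite actE; apply: rpredM; last exact: yP.
  by apply: rpred_sum => b _; apply: rpredM; [exact: yP | exact: xGP].
suff : ev (act y (act x G)) p / ev (act y (act x G)) q \in subfield_pred hP by [].
by rewrite rpred_div //; apply: MP.
Qed.


End ZariskiDensity.

Section Invariants.
Variables (C : numClosedFieldType) (k n : nat).
Hypotheses (k2 : (2 <= k)%N) (kn : (k < n)%N).

Local Notation K := (ratVn C k n).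
Local Notation G := (generic_mx C k n).
Local Notation iK := (iotaK C k n).
Local Notation ev := (pev iK).

Variables (p q : {mpoly C[k * n]}).
Hypothesis q0 : q != 0.
Hypothesis inv_SL : forall g : 'M[C]_k, \det g = 1 ->
  rsubst (SLmx n g) (tofrac p / tofrac q) = tofrac p / tofrac q.
Hypothesis inv_T : forall t : 'rV[C]_n, (forall i, t 0 i != 0) ->
  rsubst (Tmx k t) (tofrac p / tofrac q) = tofrac p / tofrac q.

Lemma cross_subst (N : 'M[{mpoly C[k * n]}]_(k, n)) :
  injective (tofrac \o subst N) ->
  rsubst N (tofrac p / tofrac q) = tofrac p / tofrac q ->
  subst N p * q = p * subst N q.
Proof.
move=> N_inj; rewrite /rsubst (frac_extE N_inj) //=.
move/eqP; rewrite GRing.eqr_div ?tofrac_eq0 //; last first.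
  apply: contra_neq q0 => e; apply: N_inj; by rewrite /= e !rmorph0.
by rewrite -!tofracM tofrac_eq => /eqP.
Qed.

Lemma cross_SL (g : 'M[C]_k) (M : 'M[K]_(k, n)) : \det g = 1 ->
  ev (map_mx iK g *m M) p * ev M q = ev M p * ev (map_mx iK g *m M) q.
Proof.
move=> dg; have gu : g \in unitmx by rewrite unitmxE dg unitr1.
exact: pev_cross_SL (cross_subst (SLmx_inj gu) (inv_SL dg)).
Qed.

Lemma cross_T (t : 'rV[C]_n) (M : 'M[K]_(k, n)) : (forall i, t 0 i != 0) ->
  ev (M *m diag_mx (map_mx iK t)) p * ev M q = ev M p * ev (M *m diag_mx (map_mx iK t)) q.
Proof.
by move=> t0; exact: pev_cross_T (cross_subst (@Tmx_inj C k n t t0) (inv_T t0)).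
Qed.

(** Over an algebraically closed field [g] is a k-th root of its determinant times an element of
    SL_k, and the scalar is absorbed into the torus. *)
Lemma cross_GL (g : 'M[C]_k) (t : 'rV[C]_n) : \det g != 0 -> (forall i, t 0 i != 0) ->
  let M := map_mx iK g *m G *m diag_mx (map_mx iK t) in
  ev M p * ev G q = ev G p * ev M q.
Proof.
move=> dg t0 M; pose l := k.-root (\det g).
have lk : l ^+ k = \det g by rewrite rootCK // ltnW.
have l0 : l != 0.
  by apply: contra_neq dg => l0; rewrite -lk l0 expr0n; case: k k2.
pose g' := l^-1 *: g; pose t' := l *: t.
have dg' : \det g' = 1 by rewrite detZ -lk exprVn mulVf // expf_neq0.
have t'0 i : t' 0 i != 0 by rewrite mxE mulf_neq0.
pose B := G *m diag_mx (map_mx iK t').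
have ME : M = map_mx iK g' *m B.
  rewrite /M /B /g' /t' !map_mxZ linearZ /= -scalemxAr -scalemxAl -scalemxAr.
  have ll : iK l^-1 * iK l = 1 by rewrite -rmorphM mulVf // rmorph1.
  by rewrite scalerA [X in X *: _]ll scale1r mulmxA.
(* The SL_k and torus identities are chained at [B], so [q] must be nonzero there; this follows from
   injectivity of the torus substitution. *)
have Bq : ev B q != 0.
  have -> : ev B q = tofrac (subst (Tmx k t') q) by rewrite -pev_G pev_subst pev_Tmx.
  rewrite tofrac_eq0.
  apply: contra_neq q0 => e; apply: (@Tmx_inj C k n t' t'0).
  by rewrite /= e !rmorph0.
have e1 := cross_SL B dg'; have e2 := cross_T G t'0.
rewrite -ME in e1; rewrite -/B in e2.
exact: (cross_mul_trans Bq e1 e2).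
Qed.

End Invariants.

(** * Propagation from the initial seed along mutations *)

Section Propagation.
Variables (C LX LA : fieldType) (iota : {rmorphism C -> LX}) (pst : {rmorphism LX -> LA}).
Variables (I : finType) (fr : {set I}).
Local Notation J := (unfrozen fr).

(** An [X_family] is defined on all seeds, so a preimage under [pst] is chosen where one exists,
    with default 0. Injectivity of [pst] makes the choice unique. *)
Definition Xcoord (S : seed I LA) (i : J) : LX :=
  if pselect (exists x, pst x = xmono S (val i)) is left e then sval (cid e) else 0.

Lemma XcoordE S (x : J -> LX) : (forall i, pst (x i) = xmono S (val i)) -> Xcoord S = x.
Proof.
move=> xE; apply: funext => i; rewrite /Xcoord; case: pselect => [e|[]]; last by exists (x i).
by case: cid => z zE; apply: (fmorph_inj pst); rewrite zE xE.
Qed.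

(** Invariant of the induction over mutations: birationality keeps 1 + [xmono] nonzero, hence the
    next cluster variables too, which the mutation rule for monomials requires. *)
Definition good_seed S : Prop :=
  [/\ forall j, clvar S j != 0,
      forall i, pst (Xcoord S i) = xmono S (val i)
    & birational_coordinates iota (Xcoord S)].

Lemma Xcoord_neqN1 S (m : J) : good_seed S -> 1 + xmono S (val m) != 0.
Proof.
move=> [_ pX bir]; rewrite -pX -(rmorph1 pst) -rmorphD fmorph_eq0.
rewrite addrC -[1]opprK subr_eq0 -(rmorph1 iota) -rmorphN.
exact: birational_neqC.
Qed.

Lemma Xcoord_mutate S (m : J) : good_seed S ->
  Xcoord (mutate (val m) S) = mutX (exch S) (Xcoord S) m.
Proof.
move=> gS; have X1 := Xcoord_neqN1 m gS; have [A0 pX _] := gS.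
apply: XcoordE => i; rewrite xmono_mutateX // rmorph_mutX.
by rewrite (_ : pst \o Xcoord S = fun j => xmono S (val j)) //; apply: funext.
Qed.

Lemma good_seed_mutate S (m : J) : good_seed S -> good_seed (mutate (val m) S).
Proof.
move=> gS; have X1 := Xcoord_neqN1 m gS; have [A0 pX bir] := gS.
have XM := Xcoord_mutate m gS; split; first exact: clvar_mutate_neq0.
  move=> i; rewrite XM xmono_mutateX // rmorph_mutX.
  by rewrite (_ : pst \o Xcoord S = fun j => xmono S (val j)) //; apply: funext.
by rewrite XM; apply: birational_mutX.
Qed.

Lemma mutation_equivalent_good S0 S :
  good_seed S0 -> mutation_equivalent fr S0 S -> good_seed S.
Proof.
move=> g0; elim=> // {}S m mJ _.
exact: (@good_seed_mutate S (exist _ m mJ)).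
Qed.

End Propagation.

Section Ensemble.
Variables (C : numClosedFieldType) (k n : nat).
Hypotheses (k2 : (2 <= k)%N) (kn : (k < n)%N).

Local Notation K := (ratVn C k n).
Local Notation S0 := (initial_seed k n C).
Local Notation J := (unfrozen (frozen k n)).

Definition kappa : {rmorphism ratConfP C k n -> K} := confV_val C k n \o pstar C k n.

Lemma kappa_in_subfield (P : {pred K}) (hP : divring_closed P) (f : ratConfP C k n) :
  (forall c, iotaK C k n c \in P) ->
  (forall b j, (b.+2 <= k)%N -> (j.+2 <= n - k)%N ->
     Xratio (minor (cols (generic_mx C k n))) b j \in P) ->
  kappa f \in P.
Proof.
move=> cP XP; pose F := kappa f; pose p := \n_(repr F); pose q := \d_(repr F).
have FE : F = tofrac p / tofrac q := frac_repr F.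
have q0 : q != 0 := denom_ratioP _.
have Gq : pev (iotaK C k n) (generic_mx C k n) q != 0 by rewrite pev_G tofrac_eq0.
have iSL (g : 'M[C]_k) : \det g = 1 ->
    rsubst (SLmx n g) (tofrac p / tofrac q) = tofrac p / tofrac q.
  by rewrite -FE => dg; have /asboolP/(_ g dg) := valP (val f).
have iT (t : 'rV[C]_n) : (forall i, t 0 i != 0) ->
    rsubst (Tmx k t) (tofrac p / tofrac q) = tofrac p / tofrac q.
  by rewrite -FE => t0; have /asboolP/(_ t t0) := valP f.
rewrite -[kappa f]/F FE -!pev_G.
apply: (invariant_in_subfield k2 kn Gq _ hP cP _ XP); last exact: minorG_neq0.
by move=> g t dg t0; apply: (cross_GL k2 q0 iSL iT).
Qed.

Lemma initial_birational (x : J -> ratConfP C k n) :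
  (forall i, pstar C k n (x i) = xmono S0 (val i)) ->
  birational_coordinates (@constP C k n) x.
Proof.
move=> xE; pose y (i : J) := confV_val C k n (xmono S0 (val i)).
apply: (@birational_embed _ _ _ K kappa J x (iotaK C k n) y) => [c|i||f].
- by [].
- by rewrite /y -xE.
- exact: initial_alg_indep.
apply: kappa_in_subfield => [|c|b j bk jn]; first exact: gen_divring.
  exact: gen_const.
have bk' : (b < k)%N by lia.
have jn' : (j < n - k)%N by lia.
(* The bounds on b and j say exactly that this vertex is unfrozen, so the ratio is one of the
   coordinates. *)
pose w := (Ordinal bk', Ordinal jn').
have wJ : Some w \notin frozen k n.
  by rewrite inE /row_of /col_of /= negb_or; apply/andP; lia.
pose i : J := exist _ (Some w) wJ.
have -> : Xratio (minor (cols (generic_mx C k n))) b j = y i.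
  by rewrite /y (@xmono_initial C k n k2 kn w).
have := gen_var (iotaK C k n) (fun i : 'I_#|(J : finType)| => y (enum_val i)) (enum_rank i).
by rewrite enum_rankK.
Qed.

Lemma initial_good : good_seed (@constP C k n) (pstar C k n) (frozen k n) S0.
Proof.
have [x xE] := exists_initial_X C k2 kn; have XE := XcoordE xE.
split; first exact: clvar_initial_neq0.
  by rewrite XE.
by rewrite XE; apply: initial_birational.
Qed.

Lemma cluster_ensemble_ConfP : exists X : X_family k n C,
  cluster_X_structure X /\ cluster_ensemble X.
Proof.
exists (@Xcoord _ _ (pstar C k n) _ (frozen k n)).
split=> S /(mutation_equivalent_good initial_good) gS; last by case: gS.
split=> [|m i]; first by case: gS.
by rewrite (Xcoord_mutate m gS).
Qed.

End Ensemble.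

Theorem theorem8p1 (R : realType) (k n : nat) (hk : (2 <= k)%N) (hkn : (k < n)%N) :
  exists X : X_family k n R[i]%C,
    cluster_X_structure X /\ cluster_ensemble X.
Proof. exact: (@cluster_ensemble_ConfP R[i]%C k n hk hkn). Qed.
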